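(* Let $K$ be any field and $f\in\mathfrak m\subset R$. 1. $f$ is finitely contact determined if and only if $\tau(f)<\infty$. 2. $f$ is finitely right determined if and only if $\mu(f)<\infty$. Moreover, if $\tau(f)<\infty$ then $f$ is contact $(2\tau(f)-\mathrm{ord}(f)+2)$-determined, and if $\mu(f)<\infty$ then $f$ is right $(2\mu(f)-\mathrm{ord}(f)+2)$-determined.
   Context: $R=K[[x_1,\dots,x_s]]$, $\mathfrak m=\langle x_1,\dots,x_s\rangle$, $Aut(R)$ the group of $K$-algebra automorphisms of $R$. $f$ is right equivalent to $g$ if $\phi(f)=g$ for some $\phi\in Aut(R)$; $f$ is right $k$-determined if every $g$ with $f-g\in\mathfrak m^{k+1}$ is right equivalent to $f$. $f$ is contact $k$-determined if every $g$ with $f-g\in\mathfrak m^{k+1}$ satisfies $R/\langle f\rangle\cong R/\langle g\rangle$ as local $K$-algebras. ''Finitely (contact/right) determined'' means $k$-determined for some $k$. $\tau(f)=\dim_K R/\langle f,\partial f/\partial x_1,\dots,\partial f/\partial x_s\rangle$ (Tjurina number), $\mu(f)=\dim_K R/\langle\partial f/\partial x_1,\dots,\partial f/\partial x_s\rangle$ (Milnor number), and $\mathrm{ord}(f)$ is the lowest degree of a nonzero homogeneous part of $f$. *)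

(* Defs.v *)
From HB Require Import structures.
From mathcomp Require Import all_boot all_order all_algebra.
Set Implicit Arguments. Unset Strict Implicit. Unset Printing Implicit Defensive.
Import GRing.Theory.
Local Open Scope ring_scope.

Definition mono (s : nat) := {ffun 'I_s -> nat}.
Definition mdeg (s : nat) (a : mono s) : nat := (\sum_(i < s) a i)%N.

(* R = K[[x_1,...,x_s]]: a series is its coefficient function *)
Definition ps (K : fieldType) (s : nat) := mono s -> K.

Section PS.
Variables (K : fieldType) (s : nat).
Implicit Types (f g h : ps K s) (a : mono s).

Definition ps1 : ps K s := fun a => if mdeg a == 0%N then 1 else 0.
Definition psadd f g : ps K s := fun a => f a + g a.
Definition pssub f g : ps K s := fun a => f a - g a.
Definition psscale (c : K) f : ps K s := fun a => c * f a.
(* Cauchy product: sum over all b <= a componentwise (b_i <= a_i <= mdeg a) *)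
Definition psmul f g : ps K s := fun a =>
  \sum_(b : {ffun 'I_s -> 'I_(mdeg a).+1} | [forall i, (b i <= a i)%N])
     f [ffun i => nat_of_ord (b i)] * g [ffun i => (a i - b i)%N].
Definition pssum (n : nat) (F : 'I_n -> ps K s) : ps K s :=
  fun a => \sum_(j < n) F j a.
Definition psderiv (i : 'I_s) f : ps K s :=
  fun a => (a i).+1%:R * f [ffun j => (a j + (j == i))%N].

Definition in_max f : Prop := f [ffun=> 0%N] = 0.
(* h lies in m^(k+1), i.e. all coefficients of total degree <= k vanish *)
Definition in_mpow (k : nat) h : Prop := forall a, (mdeg a <= k)%N -> h a = 0.

Definition in_ideal (n : nat) (gs : 'I_n -> ps K s) h : Prop :=
  exists cs : 'I_n -> ps K s, forall a, h a = pssum (fun j => psmul (cs j) (gs j)) a.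

Definition quot_dim (n : nat) (gs : 'I_n -> ps K s) (t : nat) : Prop :=
  exists v : 'I_t -> ps K s,
    (forall h, exists c : 'I_t -> K,
        in_ideal gs (pssub h (pssum (fun j => psscale (c j) (v j))))) /\
    (forall c : 'I_t -> K,
        in_ideal gs (pssum (fun j => psscale (c j) (v j))) -> forall j, c j = 0).

Definition tjurina_gens f : 'I_s.+1 -> ps K s :=
  fun j => match unlift ord0 j with None => f | Some i => psderiv i f end.
Definition milnor_gens f : 'I_s -> ps K s := fun i => psderiv i f.

Definition tjurina_eq f (t : nat) : Prop := quot_dim (tjurina_gens f) t.
Definition milnor_eq f (m : nat) : Prop := quot_dim (milnor_gens f) m.

Definition is_ord f (d : nat) : Prop :=
  (exists a, mdeg a = d /\ f a <> 0) /\ (forall a, (mdeg a < d)%N -> f a = 0).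

Definition is_Kalg_aut (phi : ps K s -> ps K s) : Prop :=
  bijective phi /\
  (forall f g a, phi (psadd f g) a = psadd (phi f) (phi g) a) /\
  (forall f g a, phi (psmul f g) a = psmul (phi f) (phi g) a) /\
  (forall a, phi ps1 a = ps1 a) /\
  (forall c f a, phi (psscale c f) a = psscale c (phi f) a).

Definition right_equiv f g : Prop :=
  exists phi, is_Kalg_aut phi /\ forall a, phi f a = g a.

Definition right_det f (k : nat) : Prop :=
  forall g, in_mpow k (pssub f g) -> right_equiv f g.

Definition in_pideal f h : Prop := in_ideal (fun _ : 'I_1 => f) h.

(* R/<f> ~= R/<g> as (local) K-algebras; the isomorphism is given on
   representatives by Phi : R -> R *)
Definition contact_equiv f g : Prop :=
  exists Phi : ps K s -> ps K s,
    (forall u v, in_pideal f (pssub u v) -> in_pideal g (pssub (Phi u) (Phi v))) /\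
    (forall u v, in_pideal g (pssub (Phi (psadd u v)) (psadd (Phi u) (Phi v)))) /\
    (forall u v, in_pideal g (pssub (Phi (psmul u v)) (psmul (Phi u) (Phi v)))) /\
    in_pideal g (pssub (Phi ps1) ps1) /\
    (forall c u, in_pideal g (pssub (Phi (psscale c u)) (psscale c (Phi u)))) /\
    (forall u, in_pideal g (Phi u) -> in_pideal f u) /\
    (forall h, exists u, in_pideal g (pssub h (Phi u))).

Definition contact_det f (k : nat) : Prop :=
  forall g, in_mpow k (pssub f g) -> contact_equiv f g.

End PS.

(* Main.v *)
Require Import Defs.
From HB Require Import structures.
From mathcomp Require Import all_boot all_order all_algebra.
From mathcomp Require Import boolp.
From mathcomp Require Import ring zify.
Set Implicit Arguments. Unset Strict Implicit. Unset Printing Implicit Defensive.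
Import GRing.Theory.
Local Open Scope ring_scope.

(** If [m^k] lies in the Tjurina (or Milnor) ideal of [f] and [g - f] has high order,
    the equation [(1 + a) f(x + b) = g] (with [a = 0] in the right case) is solved by
    successive approximation: by Taylor expansion the linearised equation at each stage
    is solvable in the fixed ideal of [f], and [x + b] is tangent to the identity.
    A codimension [t] gives [m^t] inside the ideal by Nakayama's lemma, so [k = t] works.

    Conversely, a [k]-determined [f] is equivalent to [g = f_{<=k} + sum_i x_i^(D+1)]
    with [D >= k] and [D + 1] invertible in [K], whose Milnor number is finite over any
    field. Finiteness passes from [g] to [f] by the chain rule: the equivalence
    is a coordinate change [z] modulo any power of [m], with invertible Jacobian. For
    contact equivalence this needs [f] in [m^2]; otherwise the Tjurina ideal is [R]. *)

(** The bound [2 * k + 2 - d] is the price of keeping the ideal of [f] fixed. If [f] lies in m^d and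
    the coordinate change moves points by m^q, then a partial derivative of [f] moves by m^(q+d-2).
    A correction solved in the fixed ideal therefore improves the order of the error only if q + d -
    2 is at least k + 1. This gives q = k + 3 - d, and the first error [g - f] must lie in m^(k+q) =
    m^(2k+3-d). Only a first-order Taylor formula is used, and its remainder is bounded without
    second derivatives. In the converse direction the obstacle is that an equivalence is an abstract
    map of algebras, with no continuity assumed. It cannot simply be declared a substitution:
    algebraic identities determine it only on finite expansions, with an error in m^n for each n.
    Arguments are therefore run in the ideal plus a power of m, and Nakayama's lemma removes that
    power at the end. *)

Section Monomials.
Variable s : nat.
Implicit Types a b c : mono s.

Definition madd a b : mono s := [ffun i => (a i + b i)%N].
Definition msub a b : mono s := [ffun i => (a i - b i)%N].
Definition mle a b := [forall i, (a i <= b i)%N].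
Definition mone (i : 'I_s) : mono s := [ffun j => nat_of_bool (j == i)].
Definition mzero : mono s := [ffun=> 0%N].

Lemma mleP a b : reflect (forall i, (a i <= b i)%N) (mle a b).
Proof. exact: forallP. Qed.

Lemma maddC a b : madd a b = madd b a.
Proof. by apply/ffunP => i; rewrite !ffunE addnC. Qed.
Lemma maddA a b c : madd a (madd b c) = madd (madd a b) c.
Proof. by apply/ffunP => i; rewrite !ffunE addnA. Qed.
Lemma maddK a b : msub (madd a b) b = a.
Proof. by apply/ffunP => i; rewrite !ffunE addnK. Qed.
Lemma msubK a b : mle b a -> madd (msub a b) b = a.
Proof. by move/mleP => h; apply/ffunP => i; rewrite !ffunE subnK. Qed.
Lemma mle_maddr a b : mle a (madd b a).
Proof. by apply/mleP => i; rewrite ffunE leq_addl. Qed.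

Lemma mdegD a b : mdeg (madd a b) = (mdeg a + mdeg b)%N.
Proof. by rewrite /mdeg -big_split; apply: eq_bigr => i _; rewrite ffunE. Qed.
Lemma mdeg_ge a i : (a i <= mdeg a)%N.
Proof. by rewrite /mdeg (bigD1 i) //= leq_addr. Qed.
Lemma mdeg0 : mdeg mzero = 0%N.
Proof. by rewrite /mdeg big1 // => i _; rewrite ffunE. Qed.
Lemma mdeg_mone i : mdeg (mone i) = 1%N.
Proof.
rewrite /mdeg (bigD1 i) //= ffunE eqxx big1 // => j /negPf h.
by rewrite ffunE h.
Qed.
Lemma mdeg_eq0 a : (mdeg a == 0%N) = (a == mzero).
Proof.
apply/idP/eqP => [h|->]; last by rewrite mdeg0.
by apply/ffunP => i; rewrite ffunE; apply/eqP; rewrite -leqn0 -(eqP h) mdeg_ge.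
Qed.
Lemma mle_mone a i : mle (mone i) a = (0 < a i)%N.
Proof.
apply/mleP/idP => [/(_ i)|h j]; rewrite ffunE ?eqxx //.
by case: eqP => [->|].
Qed.
Lemma madd0 a : madd a mzero = a.
Proof. by apply/ffunP => i; rewrite !ffunE addn0. Qed.
Lemma msub0 a : msub a mzero = a.
Proof. by apply/ffunP => i; rewrite !ffunE subn0. Qed.

(** The index type of [psmul f g a] depends on [a]. One finite, downward closed list shared by all
    coefficients lets sums be exchanged and products be iterated. *)
Definition boxes n : seq (mono s) :=
  [seq [ffun i => nat_of_ord (b i)] | b : {ffun 'I_s -> 'I_n.+1}].

Lemma boxes_uniq n : uniq (boxes n).
Proof.
rewrite map_inj_uniq ?enum_uniq // => b c /ffunP h.
by apply/ffunP => i; apply: val_inj; have := h i; rewrite !ffunE.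
Qed.

Lemma mem_boxes n a : (a \in boxes n) = [forall i, (a i <= n)%N].
Proof.
apply/mapP/forallP => [[b _ ->] i|h]; first by rewrite ffunE -ltnS.
exists [ffun i => inord (a i)]; first by rewrite mem_enum.
by apply/ffunP => i; rewrite !ffunE inordK // ltnS.
Qed.

Lemma mdeg_boxes n a : (mdeg a <= n)%N -> a \in boxes n.
Proof.
by move=> h; rewrite mem_boxes; apply/forallP => i; apply: leq_trans (mdeg_ge a i) h.
Qed.

Lemma boxes_le n a b : mle b a -> a \in boxes n -> b \in boxes n.
Proof.
rewrite !mem_boxes => /mleP h /forallP k; apply/forallP => i.
exact: leq_trans (h i) (k i).
Qed.
End Monomials.

(** * Ring structure on power series *)

Section Ring.
Variables (K : fieldType) (s : nat).
Implicit Types (f g h : ps K s) (a b c : mono s).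

Lemma psmul_box n f g a : a \in boxes s n ->
  psmul f g a = \sum_(b <- boxes s n | mle b a) f b * g (msub a b).
Proof.
move=> an.
transitivity (\sum_(b <- boxes s (mdeg a) | mle b a) f b * g (msub a b)).
  rewrite big_map /= big_enum_cond /psmul.
  apply: eq_big => [b|b _].
    by rewrite /mle; apply: eq_forallb => i; rewrite ffunE.
  by congr (_ * g _); apply/ffunP => i; rewrite !ffunE.
rewrite -big_filter -[RHS]big_filter.
apply/perm_big/uniq_perm; rewrite ?filter_uniq ?boxes_uniq // => b.
rewrite !mem_filter; case: (boolP (mle b a)) => //= h.
by rewrite !(boxes_le h) // mdeg_boxes.
Qed.

Lemma sum_box1 n (V : nmodType) (F : mono s -> V) a :
  \sum_(b <- boxes s n | b == a) F b = if a \in boxes s n then F a else 0.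
Proof.
case: ifPn => h.
  rewrite big_mkcond (bigD1_seq a) ?boxes_uniq //= eqxx big1 ?addr0 // => b.
  by move/negPf->.
rewrite big_seq_cond big1 // => b /andP[hb /eqP e].
by rewrite e (negPf h) in hb.
Qed.

Lemma psmul_box2 n f g a : a \in boxes s n ->
  psmul f g a = \sum_(b <- boxes s n) \sum_(c <- boxes s n | madd b c == a) f b * g c.
Proof.
move=> an; rewrite (psmul_box f g an) big_mkcond; apply: eq_bigr => b _.
case: (boolP (mle b a)) => [h|h]; last first.
  rewrite big1 // => c /eqP e; case/negP: h.
  by rewrite -e maddC mle_maddr.
rewrite (eq_bigl (fun c => c == msub a b)); last first.
  move=> c /=; apply/eqP/eqP => [<-|->]; first by rewrite maddC maddK.
  by rewrite maddC msubK.
rewrite sum_box1 ifT //; apply: boxes_le an.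
by rewrite -[X in mle _ X](msubK h) maddC mle_maddr.
Qed.

Lemma boxes_maddl n a b : madd a b \in boxes s n -> a \in boxes s n.
Proof. by apply: boxes_le; rewrite maddC mle_maddr. Qed.

Lemma mdeg_box a : a \in boxes s (mdeg a). Proof. exact: mdeg_boxes. Qed.

Lemma psmulC : commutative (@psmul K s).
Proof.
move=> f g; apply/funext => a; rewrite !(psmul_box2 _ _ (mdeg_box a)).
under eq_bigr do rewrite big_mkcond.
rewrite exchange_big; apply: eq_bigr => b _ /=.
rewrite [RHS]big_mkcond; apply: eq_bigr => c _ /=.
by rewrite maddC mulrC.
Qed.

(** The form is symmetric in the three factors up to reindexing, so associativity reduces to
    exchanging sums. *)
Lemma psmul3 n f g h a : a \in boxes s n ->
  psmul f (psmul g h) a = \sum_(b <- boxes s n) \sum_(c <- boxes s n)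
     \sum_(e <- boxes s n) if madd b (madd c e) == a then f b * (g c * h e) else 0.
Proof.
move=> an; rewrite (psmul_box2 _ _ an); apply: eq_bigr => b _.
transitivity (\sum_(d <- boxes s n | madd b d == a) \sum_(c <- boxes s n)
   \sum_(e <- boxes s n) if madd c e == d then f b * (g c * h e) else 0).
  rewrite big_seq_cond [RHS]big_seq_cond; apply: eq_bigr => d /andP[dn _].
  rewrite (psmul_box2 _ _ dn) big_distrr; apply: eq_bigr => c _ /=.
  by rewrite big_distrr /= big_mkcond.
rewrite exchange_big; apply: eq_bigr => c _ /=.
rewrite exchange_big /=; apply: eq_bigr => e _ /=.
rewrite big_mkcond.
transitivity (\sum_(d <- boxes s n | d == madd c e)
   if madd b d == a then f b * (g c * h e) else 0).
  rewrite [RHS]big_mkcond; apply: eq_bigr => d _.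
  by rewrite (eq_sym d); do 2!case: ifP.
rewrite sum_box1; case: ifPn => // hn; case: eqP => // h2; case/negP: hn.
by apply: (@boxes_maddl _ _ b); rewrite maddC h2.
Qed.

Lemma psmulA : associative (@psmul K s).
Proof.
move=> f g h; apply/funext => a.
rewrite (psmulC (psmul f g) h) !(psmul3 _ _ _ (mdeg_box a)).
rewrite [RHS]exchange_big /=; apply: eq_bigr => b _.
rewrite [RHS]exchange_big /=; apply: eq_bigr => c _; apply: eq_bigr => e _.
by rewrite [madd e _]maddC -maddA [h e * _]mulrC mulrA.
Qed.

Lemma psaddA : associative (@psadd K s).
Proof. by move=> f g h; apply/funext => a; rewrite /psadd addrA. Qed.
Lemma psaddC : commutative (@psadd K s).
Proof. by move=> f g; apply/funext => a; rewrite /psadd addrC. Qed.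
Lemma ps0add : left_id (fun=> 0 : K) (@psadd K s).
Proof. by move=> f; apply/funext => a; rewrite /psadd add0r. Qed.
Lemma psNadd : left_inverse (fun=> 0 : K) (fun f : ps K s => (fun a => - f a) : ps K s) (@psadd K s).
Proof. by move=> f; apply/funext => a; rewrite /psadd addNr. Qed.

Lemma psmul1 : left_id (@ps1 K s) (@psmul K s).
Proof.
move=> f; apply/funext => a; rewrite (psmul_box _ _ (mdeg_box a)).
transitivity (\sum_(b <- boxes s (mdeg a) | b == mzero s) f (msub a b)).
  rewrite big_mkcond [RHS]big_mkcond; apply: eq_bigr => b _.
  rewrite /ps1 mdeg_eq0; case: eqP => [->|_]; last by rewrite mul0r if_same.
  by rewrite ifT ?mul1r //; apply/mleP => i; rewrite ffunE.
by rewrite sum_box1 ifT ?msub0 // mdeg_boxes // mdeg0.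
Qed.

Lemma psmulDl : left_distributive (@psmul K s) (@psadd K s).
Proof.
move=> f g h; apply/funext => a; rewrite /psadd /psmul -big_split.
by apply: eq_bigr => b _; rewrite mulrDl.
Qed.

Lemma ps1_neq0 : @ps1 K s <> (fun=> 0).
Proof.
move/(congr1 (@^~ (mzero s))); rewrite /ps1 mdeg0 eqxx => /eqP.
by rewrite oner_eq0.
Qed.
End Ring.

HB.instance Definition _ (K : fieldType) (s : nat) := gen_eqMixin (ps K s).
HB.instance Definition _ (K : fieldType) (s : nat) := gen_choiceMixin (ps K s).
HB.instance Definition _ (K : fieldType) (s : nat) :=
  GRing.isZmodule.Build (ps K s) (@psaddA K s) (@psaddC K s) (@ps0add K s) (@psNadd K s).
Lemma ps1_neq0b (K : fieldType) (s : nat) : @ps1 K s != 0.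
Proof. by apply/eqP/ps1_neq0. Qed.
HB.instance Definition _ (K : fieldType) (s : nat) :=
  GRing.Zmodule_isComNzRing.Build (ps K s) (@psmulA K s) (@psmulC K s)
    (@psmul1 K s) (@psmulDl K s) (@ps1_neq0b K s).


(** * Powers of the maximal ideal, constants and monomials, derivatives *)

Section Grading.
Variables (K : fieldType) (s : nat).
Implicit Types (f g h : ps K s) (a b c : mono s).

(* A record, so that membership does not unfold to a product during elaboration. *)
Record mpow n h : Prop := Mpow { mpow_coef : forall a, (mdeg a < n)%N -> h a = 0 }.

Lemma coefD f g a : (f + g) a = f a + g a. Proof. by []. Qed.
Lemma coefN f a : (- f) a = - f a. Proof. by []. Qed.
Lemma coef_sum (I : Type) (r : seq I) (P : pred I) (F : I -> ps K s) a :
  (\sum_(i <- r | P i) F i) a = \sum_(i <- r | P i) F i a.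
Proof. by apply: (big_morph (fun h : ps K s => h a)). Qed.

Lemma mpow_zero h : mpow 0 h. Proof. by []. Qed.
Lemma mpow0 n : mpow n 0. Proof. by []. Qed.
Lemma mpow_le m n h : (m <= n)%N -> mpow n h -> mpow m h.
Proof. by move=> le hn; split=> a la; apply: (mpow_coef hn); apply: leq_trans le. Qed.
Lemma mpowD n f g : mpow n f -> mpow n g -> mpow n (f + g).
Proof. by move=> [hf] [hg]; split=> a la; rewrite coefD hf // hg // addr0. Qed.
Lemma mpowN n f : mpow n f -> mpow n (- f).
Proof. by move=> [hf]; split=> a la; rewrite coefN hf // oppr0. Qed.
Lemma mpowB n f g : mpow n f -> mpow n g -> mpow n (f - g).
Proof. by move=> hf hg; apply/mpowD/mpowN. Qed.
Lemma mpow_subC n f g : mpow n (f - g) -> mpow n (g - f).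
Proof. by move=> h; rewrite -opprB; apply: mpowN. Qed.
Lemma mpow_sum n (I : Type) (r : seq I) (P : pred I) (F : I -> ps K s) :
  (forall i, P i -> mpow n (F i)) -> mpow n (\sum_(i <- r | P i) F i).
Proof. by move=> h; elim/big_ind: _ => //; apply: mpowD. Qed.
Lemma mpow_trans n f g h : mpow n (f - g) -> mpow n (g - h) -> mpow n (f - h).
Proof. by move=> h1 h2; have := mpowD h1 h2; rewrite addrA subrK. Qed.

Lemma mpowM p q f g : mpow p f -> mpow q g -> mpow (p + q) (f * g).
Proof.
move=> [hf] [hg]; split=> a la; rewrite [LHS](psmul_box _ _ (mdeg_box a)) big1 // => b ba.
case: (ltnP (mdeg b) p) => hb; first by rewrite hf // mul0r.
rewrite hg ?mulr0 //; move: (mdegD (msub a b) b); rewrite (msubK ba); lia.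
Qed.
Lemma mpowMl n f g : mpow n g -> mpow n (f * g).
Proof. exact: (@mpowM 0). Qed.
Lemma mpowMr n f g : mpow n f -> mpow n (f * g).
Proof. by rewrite mulrC; apply: mpowMl. Qed.
Lemma mpow_exp n f : mpow 1 f -> mpow n (f ^+ n).
Proof. by move=> h; elim: n => // n IH; rewrite exprS; apply: (mpowM h). Qed.

Lemma mpow_eq0 f : (forall n, mpow n f) -> f = 0.
Proof. by move=> h; apply/funext => a; apply: (mpow_coef (h (mdeg a).+1)). Qed.
Lemma mpow_eq f g : (forall n, mpow n (f - g)) -> f = g.
Proof. by move/mpow_eq0/eqP; rewrite subr_eq0 => /eqP. Qed.

Definition psC (k : K) : ps K s := fun a => if mdeg a == 0%N then k else 0.
Definition psmono a : ps K s := fun b => (b == a)%:R.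
Definition psX (i : 'I_s) : ps K s := psmono (mone i).

Lemma psCE k a : psC k a = if a == mzero s then k else 0.
Proof. by rewrite /psC mdeg_eq0. Qed.
Lemma psC_coef0 k : psC k (mzero s) = k.
Proof. by rewrite /psC mdeg0. Qed.
Lemma psCD k l : psC (k + l) = psC k + psC l.
Proof. by apply/funext => a; rewrite coefD /psC; case: ifP; rewrite ?addr0. Qed.
Lemma psC0 : psC 0 = 0.
Proof. by apply/funext => a; rewrite /psC if_same. Qed.
Lemma psC1 : psC 1 = 1. Proof. by []. Qed.
Lemma psC_mul k f a : (psC k * f) a = k * f a.
Proof.
rewrite [LHS](psmul_box _ _ (mdeg_box a)).
transitivity (\sum_(b <- boxes s (mdeg a) | b == mzero s) k * f (msub a b)).
  rewrite big_mkcond [RHS]big_mkcond; apply: eq_bigr => b _.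
  rewrite /psC mdeg_eq0; case: eqP => [->|_]; last by rewrite mul0r if_same.
  by rewrite ifT //; apply/mleP => i; rewrite ffunE.
by rewrite sum_box1 ifT ?msub0 // mdeg_boxes // mdeg0.
Qed.
Lemma psscaleE k f : psscale k f = psC k * f.
Proof. by apply/funext => a; rewrite psC_mul. Qed.
Lemma psCM k l : psC (k * l) = psC k * psC l.
Proof. by apply/funext => a; rewrite psC_mul /psC; case: ifP; rewrite ?mulr0. Qed.
Lemma psCN k : psC (- k) = - psC k.
Proof. by apply/eqP; rewrite -subr_eq0 opprK -psCD addNr psC0. Qed.
Lemma psC_sum (I : Type) (r : seq I) (P : pred I) (F : I -> K) :
  psC (\sum_(i <- r | P i) F i) = \sum_(i <- r | P i) psC (F i).
Proof. exact: (big_morph psC psCD psC0). Qed.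
Lemma psC_nat n : psC n%:R = n%:R.
Proof. by elim: n => [|n IH]; rewrite ?psC0 // -addn1 !natrD psCD IH. Qed.

Lemma psmono_mul c h a :
  (psmono c * h) a = if mle c a then h (msub a c) else 0.
Proof.
rewrite [LHS](psmul_box _ _ (mdeg_box a)).
transitivity (\sum_(b <- boxes s (mdeg a) | b == c)
   if mle b a then h (msub a b) else 0).
  rewrite big_mkcond [RHS]big_mkcond; apply: eq_bigr => b _; rewrite /psmono.
  by case: eqP => _; case: ifP => _; rewrite ?mul1r ?mul0r.
rewrite sum_box1; case: ifPn => // hc; case: ifP => // le.
by case/negP: hc; apply: boxes_le le (mdeg_box a).
Qed.

Lemma psmonoM a b : psmono a * psmono b = psmono (madd a b).
Proof.
apply/funext => c; rewrite psmono_mul /psmono; case: ifPn => [le|nle].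
  congr (nat_of_bool _)%:R; apply/eqP/eqP => [<-|->]; first by rewrite maddC msubK.
  by rewrite maddC maddK.
by case: eqP => // e; case/negP: nle; rewrite e maddC mle_maddr.
Qed.

Lemma psX_mul i h a :
  (psX i * h) a = if (0 < a i)%N then h (msub a (mone i)) else 0.
Proof. by rewrite psmono_mul mle_mone. Qed.

Lemma mpow_psX i : mpow 1 (psX i).
Proof.
by split=> a; rewrite /psX /psmono; case: eqP => // ->; rewrite mdeg_mone.
Qed.

Lemma mpow1_coef0 h : mpow 1 h <-> h (mzero s) = 0.
Proof.
split=> [[->//]|h0]; [by rewrite mdeg0 | split=> a].
by rewrite ltnS leqn0 mdeg_eq0 => /eqP ->.
Qed.
Lemma mpow1_subC h : mpow 1 (h - psC (h (mzero s))).
Proof. by apply/mpow1_coef0; rewrite coefD coefN psC_coef0 subrr. Qed.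
Lemma mpow1_psC k : mpow 1 (psC k) -> k = 0.
Proof. by move/mpow1_coef0; rewrite psC_coef0. Qed.

Lemma psX_exp i n : psX i ^+ n = psmono [ffun j => (n * (j == i))%N].
Proof.
elim: n => [|n IH].
  rewrite expr0; apply/funext => a.
  have e : mzero s = [ffun j => (0 * (j == i))%N] by apply/ffunP => j; rewrite !ffunE.
  by rewrite -psC1 psCE /psmono -e; case: eqP.
rewrite exprS IH psmonoM; congr psmono; apply/ffunP => j; rewrite !ffunE.
by case: (eqVneq j i) => _ /=; lia.
Qed.

(* The part of [h] on the monomials whose least variable is [x_i], divided by [x_i]. *)
Definition pshd (i : 'I_s) h : ps K s := fun a =>
  if [forall j : 'I_s, (j < i)%N ==> (a j == 0%N)] then h (madd a (mone i)) else 0.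

(** Every nonconstant monomial has exactly one least variable, so exactly one summand contributes to
    its coefficient. *)
Lemma pshd_decomp h : h = psC (h (mzero s)) + \sum_i psX i * pshd i h.
Proof.
apply/funext => a; rewrite coefD coef_sum /psC mdeg_eq0.
pose P (i : 'I_s) := (0 < a i)%N && [forall j : 'I_s, (j < i)%N ==> (a j == 0%N)].
transitivity ((if a == mzero s then h (mzero s) else 0) + \sum_i if P i then h a else 0).
  case: eqP => [e|/eqP a0].
    by rewrite big1 ?addr0 ?e // => i _; rewrite /P e ffunE.
  rewrite add0r.
  have [i0 hi0] : exists i, (0 < a i)%N.
    apply/existsP; apply: contraR a0; rewrite negb_exists => /forallP hh.
    by apply/eqP/ffunP => i; rewrite ffunE; apply/eqP; rewrite -leqn0 leqNgt.
  case: (@arg_minnP _ i0 (fun i => 0 < a i)%N (fun i => nat_of_ord i) hi0) => i hi mi.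
  rewrite -big_mkcond (big_pred1 i) // => j; rewrite /P /=.
  apply/andP/eqP => [[hj /forallP /(_ i)]|->].
    have := mi j hj; rewrite leq_eqVlt => /orP[/eqP/val_inj//|->] /=; lia.
  split=> //; apply/forallP => l; apply/implyP => li; apply/eqP.
  by case: (posnP (a l)) => // /mi; lia.
congr (_ + _); apply: eq_bigr => i _; rewrite psX_mul /P; case: posnP => //= ai.
rewrite /pshd msubK ?mle_mone //.
rewrite (_ : [forall j : 'I_s, (j < i)%N ==> (msub a (mone i) j == 0%N)] =
             [forall j : 'I_s, (j < i)%N ==> (a j == 0%N)]) //.
apply: eq_forallb => j; case: ltnP => //= ji; rewrite !ffunE.
by case: (eqVneq j i) => [e|_]; [move: ji; rewrite e ltnn | rewrite subn0].
Qed.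

Lemma mpow_pshd n i h : mpow n.+1 h -> mpow n (pshd i h).
Proof.
by move=> [hn]; split=> a la; rewrite /pshd; case: ifP => // _; rewrite hn // mdegD mdeg_mone addn1.
Qed.

Lemma mpowS_decomp n h : mpow n.+1 h -> h = \sum_i psX i * pshd i h.
Proof.
move=> [hn]; rewrite [LHS]pshd_decomp hn ?mdeg0 // psC0.
by rewrite add0r.
Qed.

Lemma additive_sum (T : ps K s -> ps K s) (I : Type) (r : seq I) (P : pred I) F :
  (forall f g, T (f + g) = T f + T g) ->
  T (\sum_(i <- r | P i) F i) = \sum_(i <- r | P i) T (F i).
Proof.
move=> TD; apply: (big_morph T TD).
by apply: (addrI (T 0)); rewrite -TD !addr0.
Qed.

(* Induction along [h = h(0) + sum_i x_i h_i], modulo a growing power of the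
   maximal ideal: the substitute for polynomial induction in [R]. *)
Lemma mpow_raise (T : ps K s -> ps K s) N :
  (forall f g, T (f + g) = T f + T g) -> (forall k, mpow N (T (psC k))) ->
  (forall i h n, mpow n (T h) -> mpow (minn N n.+1) (T (psX i * h))) ->
  forall h, mpow N (T h).
Proof.
move=> TD TC TX; suff H n h : mpow (minn N n) (T h).
  by move=> h; have := H N h; rewrite minnn.
elim: n h => [|n IH] h; first by rewrite minn0.
rewrite (pshd_decomp h) TD; apply: mpowD.
  by apply: mpow_le (TC _); rewrite geq_minl.
rewrite additive_sum //; apply: mpow_sum => i _.
apply: mpow_le (TX _ _ _ (IH _)); lia.
Qed.

(** Applied to the difference of two sides, this proves an identity from its values on constants and
    on multiples of a variable, with no continuity argument. *)
Lemma eq0_raise (T : ps K s -> ps K s) :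
  (forall f g, T (f + g) = T f + T g) -> (forall k, T (psC k) = 0) ->
  (forall i h n, mpow n (T h) -> mpow n.+1 (T (psX i * h))) ->
  forall h, T h = 0.
Proof.
move=> TD TC TX h; apply: mpow_eq0 => n; apply: mpow_raise => // [k|i g m hm].
  by rewrite TC.
by apply: mpow_le (TX _ _ _ hm); rewrite geq_minr.
Qed.

Lemma derivD i f g : psderiv i (f + g) = psderiv i f + psderiv i g.
Proof. by apply/funext => a; rewrite /psderiv coefD mulrDr. Qed.
Lemma psderivE i f a : psderiv i f a = (a i).+1%:R * f (madd a (mone i)).
Proof. by congr (_ * f _); apply/ffunP => j; rewrite !ffunE. Qed.
Lemma derivC i k : psderiv i (psC k) = 0.
Proof.
by apply/funext => a; rewrite psderivE /psC mdegD mdeg_mone addn1 mulr0.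
Qed.
(** The only case of the Leibniz rule computed on coefficients; [eq0_raise] extends it to all
    products. *)
Lemma deriv_psXM i j h : psderiv i (psX j * h) = (i == j)%:R * h + psX j * psderiv i h.
Proof.
apply/funext => a; rewrite psderivE coefD !psX_mul psderivE.
rewrite -psC_nat psC_mul !ffunE; case: (eqVneq i j) => [<-|ij].
  rewrite addn1 ltnS leq0n maddK mul1r; case: posnP => h0.
    by rewrite h0 mul1r addr0.
  rewrite msubK ?mle_mone // subn1 prednK //.
  by rewrite -addn1 natrD mulrDl mul1r addrC.
rewrite mul0r add0r addn0 subn0.
case: posnP => h0; first by rewrite mulr0.
congr (_ * h _); apply/ffunP => l; rewrite !ffunE.
case: (eqVneq l i) => [->|_]; first by rewrite (negPf ij) !subn0.
by rewrite !addn0.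
Qed.

Lemma derivM i f g : psderiv i (f * g) = psderiv i f * g + f * psderiv i g.
Proof.
apply/eqP; rewrite -subr_eq0; apply/eqP; move: f.
apply: (eq0_raise (T := fun f => psderiv i (f * g) - (psderiv i f * g + f * psderiv i g))).
- by move=> f f'; rewrite mulrDl !derivD; ring.
- move=> k; rewrite derivC mul0r add0r; apply/eqP; rewrite subr_eq0; apply/eqP.
  by apply/funext => a; rewrite psC_mul !psderivE psC_mul; ring.
- move=> j h n; rewrite -mulrA !deriv_psXM.
  move=> hn; have := mpowM (mpow_psX j) hn; rewrite add1n.
  by congr mpow; ring.
Qed.

Lemma derivX i j : psderiv i (psX j) = (i == j)%:R.
Proof. by rewrite -[psX j]mulr1 deriv_psXM -psC1 derivC mulr1 mulr0 addr0. Qed.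
Lemma derivN i f : psderiv i (- f) = - psderiv i f.
Proof. by apply/funext => a; rewrite coefN !psderivE coefN mulrN. Qed.
Lemma mpow_deriv n i h : mpow n h -> mpow n.-1 (psderiv i h).
Proof.
move=> [hn]; split=> a la; rewrite psderivE hn ?mulr0 // mdegD mdeg_mone; lia.
Qed.
Lemma deriv_sum i (I : Type) (r : seq I) (P : pred I) (F : I -> ps K s) :
  psderiv i (\sum_(j <- r | P j) F j) = \sum_(j <- r | P j) psderiv i (F j).
Proof. by apply: additive_sum; apply: derivD. Qed.
End Grading.

(** * Substitution of series, chain rule and Taylor expansion *)

Section Substitution.
Variables (K : fieldType) (s : nat).
Implicit Types (f g h : ps K s) (a b c : mono s) (y : 'I_s -> ps K s).

Definition ymon y a : ps K s := \prod_i y i ^+ a i.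
Definition subst_box y n f : ps K s := \sum_(a <- boxes s n) psC (f a) * ymon y a.
(* The value [f(y)]; meaningful only when every [y i] lies in the maximal ideal. *)
Definition subst y f : ps K s := fun c => subst_box y (mdeg c) f c.

Lemma ymonD y a b : ymon y (madd a b) = ymon y a * ymon y b.
Proof. by rewrite /ymon -big_split; apply: eq_bigr => i _; rewrite ffunE exprD. Qed.
Lemma ymon0 y : ymon y (mzero s) = 1.
Proof. by rewrite /ymon big1 // => i _; rewrite ffunE expr0. Qed.
Lemma ymon1 y i : ymon y (mone i) = y i.
Proof.
rewrite /ymon (bigD1 i) //= ffunE eqxx expr1 big1 ?mulr1 // => j /negPf h.
by rewrite ffunE h expr0.
Qed.

Lemma subst_boxD y n f g : subst_box y n (f + g) = subst_box y n f + subst_box y n g.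
Proof.
by rewrite /subst_box -big_split; apply: eq_bigr => a _; rewrite coefD psCD mulrDl.
Qed.

Lemma sum_boxes_sub (V : nmodType) (F : mono s -> V) n m : (n <= m)%N ->
  \sum_(a <- boxes s m | a \in boxes s n) F a = \sum_(a <- boxes s n) F a.
Proof.
move=> le; rewrite -big_filter; apply/perm_big/uniq_perm; rewrite ?filter_uniq ?boxes_uniq // => a.
rewrite mem_filter; case: (boolP (a \in boxes s n)) => //=.
rewrite !mem_boxes => /forallP h; apply/forallP => i.
exact: leq_trans (h i) le.
Qed.

Lemma notin_boxes n a : a \notin boxes s n -> (n < mdeg a)%N.
Proof. by apply: contraR; rewrite -leqNgt; apply: mdeg_boxes. Qed.

Section InMax.
Variable y : 'I_s -> ps K s.
Hypothesis hy : forall i, mpow 1 (y i).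

Lemma mpow_ymon a : mpow (mdeg a) (ymon y a).
Proof.
rewrite /ymon /mdeg; elim/big_rec2: _ => // i f n _ h.
by apply: mpowM => //; apply: mpow_exp.
Qed.

(** A monomial outside the box [n] has degree above [n], and its value at [y] then lies in m^(n+1).
    Hence the box used to define a coefficient of [subst y f] may be enlarged freely. *)
Lemma subst_box_stable n m f : (n <= m)%N ->
  mpow n.+1 (subst_box y m f - subst_box y n f).
Proof.
move=> le; rewrite /subst_box -(sum_boxes_sub _ le) (bigID (fun a => a \in boxes s n)) /=.
rewrite addrC addrK; apply: mpow_sum => a /notin_boxes h.
apply: mpowMl. exact: (mpow_le h (mpow_ymon a)).
Qed.

Lemma subst_boxP n f : mpow n.+1 (subst y f - subst_box y n f).
Proof.
split=> c; rewrite ltnS => hc; rewrite coefD coefN /subst.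
have := subst_box_stable f hc; move/mpow_subC/mpow_coef/(_ c); rewrite coefD coefN; exact.
Qed.

Lemma substD f g : subst y (f + g) = subst y f + subst y g.
Proof. by apply/funext => c; rewrite coefD /subst subst_boxD. Qed.

Lemma substC k : subst y (psC k) = psC k.
Proof.
apply/funext => c; rewrite /subst.
suff -> : subst_box y (mdeg c) (psC k) = psC k by [].
transitivity (\sum_(a <- boxes s (mdeg c) | a == mzero s) psC k * ymon y a).
  rewrite [RHS]big_mkcond; apply: eq_bigr => a _; rewrite psCE.
  by case: eqP => _ //; rewrite psC0 mul0r.
by rewrite sum_box1 mdeg_boxes ?mdeg0 // ymon0 mulr1.
Qed.

Lemma substX i : subst y (psX K i) = y i.
Proof.
have H n : subst_box y n.+1 (psX K i) = y i.
  transitivity (\sum_(a <- boxes s n.+1 | a == mone i) ymon y a).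
    rewrite [RHS]big_mkcond; apply: eq_bigr => a _; rewrite {1}/psX /psmono.
    by case: eqP => _; rewrite ?psC1 ?psC0 ?mul0r ?mul1r.
  by rewrite sum_box1 mdeg_boxes ?mdeg_mone // ymon1.
apply: mpow_eq => n; apply: (@mpow_le _ _ _ n.+2); first by rewrite -addn2 leq_addr.
by rewrite -[X in _ - X](H n); apply: subst_boxP.
Qed.

Lemma mpow_subst n f : mpow n f -> mpow n (subst y f).
Proof.
move=> hf; split=> c hc; rewrite /subst.
suff /mpow_coef : mpow n (subst_box y (mdeg c) f) by apply.
apply: mpow_sum => a _; case: (ltnP (mdeg a) n) => h.
  by rewrite (mpow_coef hf) // psC0 mul0r.
by apply: mpowMl; apply: mpow_le h (mpow_ymon a).
Qed.

(** The two sides differ only by pairs of monomials of the box whose product leaves the box, and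
    these have degree above [n]. *)
Lemma subst_boxM n f g :
  mpow n.+1 (subst_box y n (f * g) - subst_box y n f * subst_box y n g).
Proof.
pose F a b := psC (f a * g b) * ymon y (madd a b).
have -> : subst_box y n f * subst_box y n g =
    \sum_(a <- boxes s n) \sum_(b <- boxes s n) F a b.
  rewrite /subst_box big_distrl; apply: eq_bigr => a _.
  rewrite big_distrr; apply: eq_bigr => b _.
  by rewrite /F psCM ymonD /=; ring.
have -> : subst_box y n (f * g) = \sum_(a <- boxes s n) \sum_(b <- boxes s n)
    if madd a b \in boxes s n then F a b else 0.
  transitivity (\sum_(c <- boxes s n) \sum_(a <- boxes s n) \sum_(b <- boxes s n)
      if c == madd a b then F a b else 0).
    rewrite /subst_box big_seq [RHS]big_seq; apply: eq_bigr => c hc.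
    rewrite [(f * g) c](psmul_box2 f g hc) psC_sum big_distrl; apply: eq_bigr => a _.
    rewrite psC_sum big_distrl /= big_mkcond; apply: eq_bigr => b _ /=.
    by rewrite /F (eq_sym c); case: eqP => // ->.
  rewrite exchange_big; apply: eq_bigr => a _ /=.
  rewrite exchange_big; apply: eq_bigr => b _ /=.
  by rewrite -big_mkcond (sum_box1 n (fun=> F a b)).
rewrite -sumrB; apply: mpow_sum => a _; rewrite -sumrB; apply: mpow_sum => b _.
case: ifPn => [_|/notin_boxes h]; first by rewrite subrr.
by rewrite sub0r; apply: mpowN; apply: mpowMl; apply: mpow_le (mpow_ymon _).
Qed.

Lemma substM f g : subst y (f * g) = subst y f * subst y g.
Proof.
apply: mpow_eq => n; apply: (mpow_le (leqnSn n)).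
apply: (mpow_trans (subst_boxP n (f * g))).
apply: (mpow_trans (subst_boxM n f g)).
have -> : subst_box y n f * subst_box y n g - subst y f * subst y g =
  subst_box y n f * (subst_box y n g - subst y g) +
  (subst_box y n f - subst y f) * subst y g by ring.
by apply: mpowD; [apply: mpowMl | apply: mpowMr]; apply/mpow_subC/subst_boxP.
Qed.

Lemma substN f : subst y (- f) = - subst y f.
Proof.
by rewrite -mulN1r substM -psC1 -psCN substC psCN psC1 mulN1r.
Qed.
Lemma substB f g : subst y (f - g) = subst y f - subst y g.
Proof. by rewrite substD substN. Qed.
Lemma subst_sum (I : Type) (r : seq I) (P : pred I) (F : I -> ps K s) :
  subst y (\sum_(i <- r | P i) F i) = \sum_(i <- r | P i) subst y (F i).
Proof. by apply: additive_sum; apply: substD. Qed.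

Lemma chain_rule j f :
  psderiv j (subst y f) = \sum_i subst y (psderiv i f) * psderiv j (y i).
Proof.
apply/eqP; rewrite -subr_eq0; apply/eqP; move: f.
apply: (eq0_raise (T := fun f => psderiv j (subst y f) -
  \sum_i subst y (psderiv i f) * psderiv j (y i))).
- move=> f g; rewrite substD derivD.
  under eq_bigr do rewrite derivD substD mulrDl.
  by rewrite big_split /=; ring.
- move=> k; rewrite substC derivC big1 ?subr0 // => i _.
  by rewrite derivC -psC0 substC psC0 mul0r.
- move=> l h n hn; have := mpowM (hy l) hn; rewrite add1n; congr mpow.
  rewrite substM substX derivM.
  have -> : \sum_i subst y (psderiv i (psX K l * h)) * psderiv j (y i) =
     subst y h * psderiv j (y l) + y l * \sum_i subst y (psderiv i h) * psderiv j (y i).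
    under eq_bigr do rewrite deriv_psXM substD !substM substX mulrDl.
    rewrite big_split big_distrr /=; congr (_ + _).
      rewrite (bigD1 l) //= eqxx -[1%:R]psC1 substC mul1r big1 ?addr0 // => i /negPf ->.
      by rewrite -psC_nat substC psC0 !mul0r.
    by apply: eq_bigr => i _; rewrite mulrA.
  ring.
Qed.
End InMax.

Section Taylor.
Variables (y c : 'I_s -> ps K s) (q : nat).
Hypotheses (hy : forall i, mpow 1 (y i)) (hc : forall i, mpow q (c i)) (q0 : (0 < q)%N).
Let z i := y i + c i.

Lemma mpow1_add i : mpow 1 (z i).
Proof. by apply: mpowD => //; apply: mpow_le (hc i). Qed.
Let hz := mpow1_add.

Lemma subst_diff_psXM i g :
  subst z (psX K i * g) - subst y (psX K i * g) =
  c i * subst z g + y i * (subst z g - subst y g).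
Proof. by rewrite !substM // !substX // /z; ring. Qed.

Lemma subst_diff0 h : mpow q (subst z h - subst y h).
Proof.
move: h; apply: (mpow_raise (T := fun h => subst z h - subst y h)).
- by move=> f g; rewrite !substD //; ring.
- by move=> k; rewrite !substC // subrr.
- move=> i g n hn; rewrite subst_diff_psXM; apply: mpowD.
    by apply: mpowMr; apply: mpow_le (hc i); rewrite geq_minl.
  by apply: mpow_le (mpowM (hy i) hn); rewrite add1n geq_minr.
Qed.

(** In a product of [e] coordinates, passing from [y] to [z] replaces at least one factor in m by
    one in m^q, a gain of [q - 1]. *)
Lemma subst_diff e h : mpow e h -> mpow (q + e - 1) (subst z h - subst y h).
Proof.
elim: e h => [|e IH] h he; first by apply: mpow_le (subst_diff0 h); lia.
rewrite (mpowS_decomp he) !subst_sum // -sumrB; apply: mpow_sum => i _.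
rewrite subst_diff_psXM; have hd := mpow_pshd i he; apply: mpowD.
  by apply: mpow_le (mpowM (hc i) (mpow_subst hz hd)); lia.
by apply: mpow_le (mpowM (hy i) (IH _ hd)); lia.
Qed.

(** The remainder [T] satisfies [T (x_i g) = y_i T g + c_i (g(z) - g(y))], so each of its terms
    carries two factors coming from [c]. No factorial is inverted, and the bound holds in every
    characteristic. *)
Lemma subst_taylor e h : mpow e h ->
  mpow (2 * q + e - 2) (subst z h - subst y h - \sum_i c i * subst y (psderiv i h)).
Proof.
pose T h := subst z h - subst y h - \sum_i c i * subst y (psderiv i h).
have TD f g : T (f + g) = T f + T g.
  rewrite /T !substD //; under eq_bigr do rewrite derivD substD // mulrDr.
  by rewrite big_split /=; ring.
have XM i g : T (psX K i * g) = y i * T g + c i * (subst z g - subst y g).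
  rewrite /T !substM // !substX // /z.
  have -> : \sum_j c j * subst y (psderiv j (psX K i * g)) =
      c i * subst y g + y i * \sum_j c j * subst y (psderiv j g).
    under eq_bigr do rewrite deriv_psXM substD // !substM // substX // mulrDr.
    rewrite big_split big_distrr /=; congr (_ + _).
      rewrite (bigD1 i) //= eqxx -[1%:R]psC1 substC // mul1r big1 ?addr0 // => j /negPf ->.
      by rewrite -psC_nat substC // psC0 mul0r mulr0.
    by apply: eq_bigr => j _; rewrite mulrCA.
  ring.
have H0 g : mpow (2 * q) (T g).
  move: g; apply: (mpow_raise (T := T)) => //.
  - move=> k; rewrite /T !substC // subrr sub0r big1 ?oppr0 // => i _.
    by rewrite derivC -psC0 substC // psC0 mulr0.
  - move=> i g n hn; rewrite XM; apply: mpowD.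
      by apply: mpow_le (mpowM (hy i) hn); rewrite add1n geq_minr.
    by apply: mpow_le (mpowM (hc i) (subst_diff0 g)); lia.
elim: e h => [|e IH] h he; first by apply: mpow_le (H0 h); lia.
rewrite -/(T h) (mpowS_decomp he) additive_sum //; apply: mpow_sum => i _.
rewrite XM; have hd := mpow_pshd i he; apply: mpowD.
  by apply: mpow_le (mpowM (hy i) (IH _ hd)); lia.
by apply: mpow_le (mpowM (hc i) (subst_diff hd)); lia.
Qed.
End Taylor.
End Substitution.

(** * Ideals, successive approximation, Nakayama's lemma and codimension *)

Section Ideals.
Variables (K : fieldType) (s : nat).
Implicit Types (f g h : ps K s) (a b c : mono s).

Definition gen_ideal n (gs : 'I_n -> ps K s) h : Prop :=
  exists cs : 'I_n -> ps K s, h = \sum_i cs i * gs i.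

Lemma pssumE n (F : 'I_n -> ps K s) : pssum F = \sum_j F j.
Proof. by apply/funext => a; rewrite coef_sum. Qed.

Lemma in_idealE n (gs : 'I_n -> ps K s) h : in_ideal gs h <-> gen_ideal gs h.
Proof.
split=> -[cs hcs]; exists cs; first by apply/funext => a; rewrite hcs pssumE.
by move=> a; rewrite pssumE hcs.
Qed.

Section GenIdeal.
Variables (n : nat) (gs : 'I_n -> ps K s).

Lemma gen_ideal0 : gen_ideal gs 0.
Proof. by exists (fun=> 0); rewrite big1 // => i _; rewrite mul0r. Qed.
Lemma gen_idealD f g : gen_ideal gs f -> gen_ideal gs g -> gen_ideal gs (f + g).
Proof.
move=> [cs ->] [ds ->]; exists (fun i => cs i + ds i); rewrite -big_split.
by apply: eq_bigr => i _ /=; rewrite mulrDl.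
Qed.
Lemma gen_idealM f g : gen_ideal gs g -> gen_ideal gs (f * g).
Proof.
move=> [cs ->]; exists (fun i => f * cs i); rewrite big_distrr.
by apply: eq_bigr => i _ /=; rewrite mulrA.
Qed.
Lemma gen_ideal_sum (I : Type) (r : seq I) (P : pred I) (F : I -> ps K s) :
  (forall i, P i -> gen_ideal gs (F i)) -> gen_ideal gs (\sum_(i <- r | P i) F i).
Proof. by move=> h; elim/big_ind: _ => //; [apply: gen_ideal0 | apply: gen_idealD]. Qed.
Lemma gen_ideal_gen i : gen_ideal gs (gs i).
Proof.
exists (fun j => (j == i)%:R); rewrite (bigD1 i) //= eqxx mul1r big1 ?addr0 //.
by move=> j /negPf ->; rewrite mul0r.
Qed.
End GenIdeal.

Lemma gen_ideal_trans n m (gs : 'I_n -> ps K s) (hs : 'I_m -> ps K s) f :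
  (forall i, gen_ideal hs (gs i)) -> gen_ideal gs f -> gen_ideal hs f.
Proof. by move=> H [cs ->]; apply: gen_ideal_sum => i _; apply: gen_idealM. Qed.

(** [P] is not assumed to be closed under limits, so the conclusion only places [u] near some
    approximant of each stage; each application passes to the limit itself. *)
Lemma successive_approx n (P : nat -> ('I_n -> ps K s) -> Prop) u0 :
  P 0%N u0 ->
  (forall m u, P m u -> exists u', P m.+1 u' /\ forall i, mpow m (u' i - u i)) ->
  exists u, forall m, exists u', P m u' /\ forall i, mpow m (u i - u' i).
Proof.
move=> P0 Pstep.
have /choice [st hst] : forall x : nat * ('I_n -> ps K s), exists u',
    P x.1 x.2 -> P x.1.+1 u' /\ forall i, mpow x.1 (u' i - x.2 i).
  move=> [m u] /=; case: (pselect (P m u)) => [/Pstep[u' hu]|hn]; first by exists u'.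
  by exists u => /hn.
pose sq := nat_rect (fun=> 'I_n -> ps K s) u0 (fun m u => st (m, u)).
have Psq m : P m (sq m) by elim: m => //= m /(hst (m, sq m))[].
have Dsq m k i : mpow m (sq (m + k)%N i - sq m i).
  elim: k => [|k IH]; first by rewrite addn0 subrr; apply: mpow0.
  have [_ /(_ i) h] := hst ((m + k)%N, sq (m + k)%N) (Psq _).
  by rewrite addnS; apply: mpow_trans IH; apply: mpow_le h; apply: leq_addr.
(* The limit is a diagonal: the coefficient at [a] is constant from stage [(mdeg a).+1] on. *)
exists (fun i a => sq (mdeg a).+1 i a) => m; exists (sq m); split=> // i.
split=> a la; rewrite coefD coefN.
have := mpow_coef (Dsq (mdeg a).+1 (m - (mdeg a).+1)%N i) (ltnSn _).
rewrite subnKC // coefD coefN => /eqP; rewrite subr_eq0 => /eqP ->.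
by rewrite subrr.
Qed.

Lemma gen_ideal_lift n (gs : 'I_n -> ps K s) j :
  (forall h, mpow j h -> exists cs, mpow j.+1 (h - \sum_i cs i * gs i)) ->
  forall r h, mpow (j + r) h -> exists cs : 'I_n -> ps K s,
    (forall i, mpow r (cs i)) /\ mpow (j + r).+1 (h - \sum_i cs i * gs i).
Proof.
move=> H; elim=> [|r IH] h.
  by rewrite addn0 => /H[cs hcs]; exists cs; split=> // i; apply: mpow_zero.
rewrite addnS => hh.
have /choice [cs hcs] l := IH _ (mpow_pshd l hh).
exists (fun i => \sum_l psX K l * cs l i); split=> [i|].
  by apply: mpow_sum => l _; rewrite -add1n; apply: mpowM (mpow_psX _ l) _; case: (hcs l).
rewrite {1}(mpowS_decomp hh).
under [X in _ - X]eq_bigr do rewrite big_distrl.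
rewrite exchange_big /= -sumrB; apply: mpow_sum => l _.
have [_ h2] := hcs l; have := mpowM (mpow_psX K l) h2; rewrite add1n; congr mpow.
by rewrite mulrBr big_distrr /=; congr (_ - _); apply: eq_bigr => i _; rewrite mulrA.
Qed.

(** An error in m^(j+r+m) is corrected with coefficients in m^(r+m), by [gen_ideal_lift], so the
    corrections converge. The bound [mpow r] on the coefficients is what keeps the steps of [newton]
    small. *)
Lemma nakayama n (gs : 'I_n -> ps K s) j :
  (forall h, mpow j h -> exists cs, mpow j.+1 (h - \sum_i cs i * gs i)) ->
  forall r h, mpow (j + r) h -> exists cs : 'I_n -> ps K s,
    (forall i, mpow r (cs i)) /\ h = \sum_i cs i * gs i.
Proof.
move=> H r h hh.
pose P m (u : 'I_n -> ps K s) := (forall i, mpow r (u i)) /\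
  mpow (j + (r + m)) (h - \sum_i u i * gs i).
have [||u hu] := @successive_approx n P (fun=> 0).
- split=> [i|]; first exact: mpow0.
  by rewrite addn0 big1 ?subr0 // => i _; rewrite mul0r.
- move=> m u [h1 h2]; have [cs [hc1 hc2]] := gen_ideal_lift H h2.
  exists (fun i => u i + cs i); split=> [|i]; last first.
    by rewrite addrC addKr; apply: mpow_le (hc1 i); apply: leq_addl.
  split=> [i|].
    by apply: mpowD => //; apply: mpow_le (hc1 i); apply: leq_addr.
  rewrite !addnS; move: hc2; congr mpow.
  by under [in RHS]eq_bigr do rewrite mulrDl; rewrite big_split opprD addrA.
exists u; split=> [i|].
  have [u' [[hu' _] hd]] := hu r.
  by rewrite -(subrK (u' i) (u i)); apply: mpowD.
apply: mpow_eq => m; have [u' [[_ h2] hd]] := hu m.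
apply: (@mpow_trans _ _ _ _ (\sum_i u' i * gs i)).
  by apply: mpow_le h2; rewrite addnA leq_addl.
rewrite -sumrB; apply: mpow_sum => i _; rewrite -mulrBl; apply: mpowMr.
exact: mpow_subC.
Qed.

Lemma nakayama_mem n (gs : 'I_n -> ps K s) j :
  (forall h, mpow j h -> exists2 h', gen_ideal gs h' & mpow j.+1 (h - h')) ->
  forall h, mpow j h -> gen_ideal gs h.
Proof.
move=> H h hh; have [||cs [_ ->]] := @nakayama n gs j _ 0 h.
- by move=> g /H[_ [cs ->] hg]; exists cs.
- by rewrite addn0.
- by exists cs.
Qed.

Lemma nontrivial_relation (t : nat) (A : 'M[K]_(t.+1, t)) :
  exists2 x : 'rV[K]_t.+1, x != 0 & x *m A = 0.
Proof.
have : kermx A != 0.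
  rewrite -mxrank_eq0 mxrank_ker subn_eq0 -ltnNge ltnS; exact: rank_leq_col.
case/rowV0Pn => x /sub_kermxP h x0; by exists x.
Qed.

(* If [m^t] is not in [I], Nakayama gives elements [h_j] of [m^j] outside
   [I + m^(j+1)] for all [j <= t]; these [t + 1] elements are independent mod [I]. *)
Lemma gen_ideal_chain n (gs : 'I_n -> ps K s) t (v : 'I_t -> ps K s) :
  (forall j h, mpow j h -> exists h' (c : 'I_t -> K), mpow j.+1 (h - h') /\
     gen_ideal gs (h' - \sum_l psC (c l) * v l)) ->
  forall h, mpow t h -> gen_ideal gs h.
Proof.
move=> H h0 hh0; apply: contrapT => nI.
have B (j : 'I_t.+1) : exists h, mpow j h /\
    forall h', gen_ideal gs h' -> ~ mpow j.+1 (h - h').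
  apply: contrapT => nB; apply: nI; apply: (@nakayama_mem _ _ j); last first.
    by apply: mpow_le hh0; rewrite -ltnS.
  move=> h hj; apply: contrapT => nh; apply: nB; exists h; split=> // h' h1 h2.
  by apply: nh; exists h'.
have /choice [hh hhh] := B.
have B2 (j : 'I_t.+1) : exists p : (ps K s) * ('I_t -> K), mpow j.+1 (hh j - p.1) /\
   gen_ideal gs (p.1 - \sum_l psC (p.2 l) * v l).
  by have [h' [c hc]] := H j (hh j) (proj1 (hhh j)); exists (h', c).
have /choice [p hp] := B2.
pose A := \matrix_(j < t.+1, l < t) (p j).2 l.
have [x x0 xA] := nontrivial_relation A.
have rel : gen_ideal gs (\sum_j psC (x 0 j) * (p j).1).
  have -> : \sum_j psC (x 0 j) * (p j).1 =
     \sum_j psC (x 0 j) * ((p j).1 - \sum_l psC ((p j).2 l) * v l).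
    under [RHS]eq_bigr do rewrite mulrBr.
    rewrite sumrB [X in _ - X](_ : _ = 0) ?subr0 //.
    under eq_bigr do rewrite big_distrr /=.
    rewrite exchange_big big1 // => l _ /=.
    under eq_bigr do rewrite mulrA -psCM.
    rewrite -big_distrl -psC_sum /=.
    suff -> : \sum_j x 0 j * (p j).2 l = 0 by rewrite psC0 mul0r.
    move/matrixP/(_ 0 l): xA; rewrite mxE [RHS]mxE => e; rewrite -[RHS]e.
    by apply: eq_bigr => j _; rewrite mxE.
  by apply: gen_ideal_sum => j _; apply/gen_idealM; case: (hp j).
have [i0 hi0] : exists j, x 0 j != 0 by apply/rV0Pn.
(* For the least index in the relation, all other terms lie in m^(j+1). Dividing by [x 0 j] puts
   [hh j] in the ideal plus m^(j+1), against its choice. *)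
case: (@arg_minnP _ i0 (fun j => x 0 j != 0) (fun j => nat_of_ord j) hi0) => j xj mj.
have [hj nj] := hhh j; have [dj _] := hp j.
apply: (nj (psC (x 0 j)^-1 * \sum_j psC (x 0 j) * (p j).1)).
  exact: gen_idealM.
apply: (@mpow_trans _ _ _ _ (p j).1) => //.
rewrite (bigD1 j) //= mulrDr mulrA -psCM mulVf // psC1 mul1r opprD addrA subrr sub0r.
apply/mpowN/mpowMl/mpow_sum => i ij.
have [->|xi] := eqVneq (x 0 i) 0; first by rewrite psC0 mul0r; apply: mpow0.
have lt : (j < i)%N by rewrite ltn_neqAle mj // andbT eq_sym.
apply: mpowMl; have [hi _] := hhh i; have [di _] := hp i.
rewrite -[(p i).1](subKr (hh i)); apply: mpowB; first exact: mpow_le hi.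
by apply: mpow_le di; apply: ltnW.
Qed.

Lemma quot_dim_mpow n (gs : 'I_n -> ps K s) t :
  quot_dim gs t -> forall h, mpow t h -> gen_ideal gs h.
Proof.
move=> [v [hv _]]; apply: (@gen_ideal_chain _ _ _ v) => j h _.
have [c /in_idealE hc] := hv h; exists h, c; rewrite subrr; split; first exact: mpow0.
move: hc; rewrite pssumE; congr (gen_ideal _ (_ - _)).
by apply: eq_bigr => l _; rewrite psscaleE.
Qed.

(** [quot_dim] asks for a basis; a spanning family is thinned by removing one dependent member at a
    time. *)
Lemma spanning_quot_dim n (gs : 'I_n -> ps K s) t (v : 'I_t -> ps K s) :
  (forall h, exists c : 'I_t -> K, gen_ideal gs (h - \sum_l psC (c l) * v l)) ->
  exists t', quot_dim gs t'.
Proof.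
have E (t' : nat) (w : 'I_t' -> ps K s) (c : 'I_t' -> K) :
    pssum (fun j => psscale (c j) (w j)) = \sum_l psC (c l) * w l.
  by rewrite pssumE; apply: eq_bigr => l _; rewrite psscaleE.
elim: t v => [|t IH] v hv.
  exists 0%N, v; split=> [h|c _ []//]; have [c hc] := hv h.
  by exists c; apply/in_idealE; rewrite E.
case: (pselect (forall c : 'I_t.+1 -> K,
  gen_ideal gs (\sum_l psC (c l) * v l) -> forall j, c j = 0)) => [ind|].
  exists t.+1, v; split=> [h|c]; last by rewrite E => /in_idealE; apply: ind.
  by have [c hc] := hv h; exists c; apply/in_idealE; rewrite E.
move=> /existsNP[c /not_implyP[hc /existsNP[j /eqP cj]]].
apply: (IH (fun l => v (lift j l))) => h; have [d hd] := hv h.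
(* Subtracting [r] times the relation [c] cancels the coefficient of [v j]. *)
pose r := d j / c j.
exists (fun l => d (lift j l) - r * c (lift j l)).
have := gen_idealD hd (gen_idealM (psC r) hc); congr gen_ideal.
have split_sum (e : 'I_t.+1 -> K) : \sum_l psC (e l) * v l =
    psC (e j) * v j + \sum_l psC (e (lift j l)) * v (lift j l).
  by rewrite (bigD1_ord j).
rewrite !split_sum.
have -> : \sum_l psC (d (lift j l) - r * c (lift j l)) * v (lift j l) =
  \sum_l psC (d (lift j l)) * v (lift j l) -
  psC r * \sum_l psC (c (lift j l)) * v (lift j l).
  rewrite big_distrr -sumrB; apply: eq_bigr => l _ /=.
  by rewrite psCD psCN psCM; ring.
have -> : psC (d j) = psC r * psC (c j) :> ps K s by rewrite -psCM divfK.
ring.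
Qed.

Lemma mpow_box_trunc M h :
  mpow M.+1 (h - \sum_(a <- boxes s M) psC (h a) * psmono K a).
Proof.
split=> b hb; rewrite coefD coefN coef_sum.
rewrite (_ : \sum_(a <- _) _ = \sum_(a <- boxes s M | a == b) h a).
  by rewrite sum_box1 mdeg_boxes // subrr.
rewrite [RHS]big_mkcond; apply: eq_bigr => a _.
by rewrite psC_mul /psmono eq_sym; case: eqP => _; rewrite ?mulr1 ?mulr0.
Qed.

Lemma mpow_quot_dim n (gs : 'I_n -> ps K s) M :
  (forall h, mpow M h -> gen_ideal gs h) -> exists t, quot_dim gs t.
Proof.
move=> H; pose B := boxes s M.
apply: (@spanning_quot_dim _ _ (size B) (fun l => psmono K (nth (mzero s) B l))) => h.
exists (fun l => h (nth (mzero s) B l)).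
apply: H; apply: (mpow_le (leqnSn M)).
have := mpow_box_trunc M h; congr mpow; congr (_ - _).
by rewrite (big_nth (mzero s)) big_mkord.
Qed.
End Ideals.

(** * Finite codimension implies determinacy *)

Section Determinacy.
Variables (K : fieldType) (s : nat).
Implicit Types (f g h u w : ps K s) (y b : 'I_s -> ps K s).

Lemma subst_id f : subst (@psX K s) f = f.
Proof.
apply/eqP; rewrite -subr_eq0; apply/eqP; move: f.
apply: (eq0_raise (T := fun f => subst (@psX K s) f - f)).
- by move=> f g; rewrite substD //; ring.
- by move=> k; rewrite substC subrr.
- move=> i h n hn; rewrite (substM (@mpow_psX K s)) (substX (@mpow_psX K s)) -mulrBr.
  exact: (mpowM (mpow_psX K i) hn).
Qed.

(** A nonzero constant term means that [u] generates R modulo m, so Nakayama's lemma with [j = 0]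
    applies. *)
Lemma inverse_exists u : u (mzero s) != 0 -> exists w, w * u = 1.
Proof.
move=> u0.
have [||cs e] := @nakayama_mem K s 1 (fun=> u) 0 _ 1; last 2 first.
- exact: mpow_zero.
- by exists (cs ord0); rewrite e big_ord1.
move=> h _; exists (psC (h (mzero s) / u (mzero s)) * u).
  exact/gen_idealM/(gen_ideal_gen (fun _ : 'I_1 => u) ord0).
by apply/mpow1_coef0; rewrite coefD coefN psC_mul divfK // subrr.
Qed.

(** The map differs from the identity by an operator that raises the order by one. Iterating this
    gives injectivity, and correcting [u] by [h - phi u] converges to a preimage. *)
Lemma subst_tangent_bij b : (forall i, mpow 2 (b i)) ->
  bijective (subst (fun i => psX K i + b i)).
Proof.
move=> hb; set phi := subst _.
have hX := @mpow_psX K s.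
have hy i : mpow 1 (psX K i + b i) by apply: mpow1_add.
have raise n h : mpow n h -> mpow n.+1 (phi h - h).
  by move=> hn; have := subst_diff hX hb (isT : 0 < 2)%N hn; rewrite subst_id add2n subn1.
have inj : injective phi.
  move=> f g e; apply: mpow_eq; elim=> [|n IH]; first exact: mpow_zero.
  have := raise _ _ IH; rewrite /phi substB // -/phi e subrr sub0r => /mpowN.
  by rewrite opprK.
have surj h : exists w, phi w = h.
  pose P m (u : 'I_1 -> ps K s) := mpow m (h - phi (u ord0)).
  have [||u hu] := @successive_approx K s 1 P (fun=> 0).
  - exact: mpow_zero.
  - move=> m u hu; exists (fun=> u ord0 + (h - phi (u ord0))); split; last first.
      by move=> i; rewrite [i]ord1 addrC addKr.
    rewrite /P /phi substD // -/phi.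
    by have /mpow_subC := raise _ _ hu; congr mpow; ring.
  exists (u ord0); apply: mpow_eq => m; have [u' [h1 h2]] := hu m.
  apply: (@mpow_trans _ _ _ _ (phi (u' ord0))); last exact: mpow_subC.
  by rewrite /phi -substB //; apply: mpow_subst.
have [psi hpsi] := choice surj.
by exists psi => // w; apply: inj; rewrite hpsi.
Qed.

(* Both ideals at once: [e = 1] gives the Tjurina ideal, [e = 0] the Milnor ideal. *)
Definition tj_gens (e : ps K s) f : 'I_s.+1 -> ps K s :=
  fun j => if unlift ord0 j is Some i then psderiv i f else e * f.

Lemma tj_gens_sum e f (cs : 'I_s.+1 -> ps K s) :
  \sum_j cs j * tj_gens e f j =
  cs ord0 * (e * f) + \sum_i cs (lift ord0 i) * psderiv i f.
Proof.
rewrite big_ord_recl {1}/tj_gens unlift_none; congr (_ + _).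
by apply: eq_bigr => i _; rewrite /tj_gens liftK.
Qed.

Lemma tjurina_gensE f : tjurina_gens f = tj_gens 1 f.
Proof.
by apply/funext => j; rewrite /tjurina_gens /tj_gens; case: unliftP => // _; rewrite mul1r.
Qed.

Lemma milnor_idealE f h : gen_ideal (milnor_gens f) h <-> gen_ideal (tj_gens 0 f) h.
Proof.
split=> -[cs ->]; last first.
  by exists (fun i => cs (lift ord0 i)); rewrite tj_gens_sum mul0r mulr0 add0r.
exists (fun j => if unlift ord0 j is Some i then cs i else 0).
rewrite tj_gens_sum mul0r mulr0 add0r.
by apply: eq_bigr => i _; rewrite liftK.
Qed.

(* Successive approximation for [(1 + e a) f(x + b) = g]: since
   [f_i(x + b) - f_i] is small, the linearised equation at every stage can be
   solved in the fixed ideal generated by [e f] and the [f_i]. *)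
Lemma newton e f g k d q : (0 < d <= k.+1)%N -> q = (k + 3 - d)%N -> mpow d f ->
  (forall h, mpow k h -> gen_ideal (tj_gens e f) h) -> mpow (k + q) (g - f) ->
  exists a b, [/\ mpow q a, forall i, mpow q (b i) &
     (1 + e * a) * subst (fun i => psX K i + b i) f = g].
Proof.
move=> /andP[d0 dk] qE fd Hk hgf.
have q0 : (0 < q)%N by lia.
have hX := @mpow_psX K s.
have Hk' r h : mpow (k + r) h -> exists cs, (forall i, mpow r (cs i)) /\
    h = \sum_i cs i * tj_gens e f i.
  apply: nakayama => h' /Hk[cs ->]; exists cs; rewrite subrr; exact: mpow0.
pose S (v : 'I_s.+1 -> ps K s) := subst (fun i => psX K i + v (lift ord0 i)) f.
pose G (v : 'I_s.+1 -> ps K s) := (1 + e * v ord0) * S v.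
pose P m (v : 'I_s.+1 -> ps K s) := (forall i, mpow q (v i)) /\ mpow (k + q + m) (g - G v).
have [||v hv] := @successive_approx K s s.+1 P (fun=> 0).
- split=> [i|]; first exact: mpow0.
  rewrite addn0 /G /S mulr0 addr0 mul1r.
  by under [fun i => psX K i + 0]funext do rewrite addr0; rewrite subst_id.
- move=> m v [hq hm].
  have [cs [hcs Ecs]] : exists cs, (forall i, mpow (q + m) (cs i)) /\
    g - G v = \sum_i cs i * tj_gens e f i by apply: Hk'; rewrite addnA.
  exists (fun i => v i + cs i); split; last first.
    by move=> i; rewrite addrC addKr; apply: mpow_le (hcs i); apply: leq_addl.
  have hq' i : mpow q (v i + cs i).
    by apply: mpowD => //; apply: mpow_le (hcs i); apply: leq_addr.
  split=> //.
  set v' := (fun i => v i + cs i).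
  pose y i := psX K i + v (lift ord0 i).
  have hy : forall i, mpow 1 (y i) by move=> i; apply: (mpow1_add hX (c := fun i => v (lift ord0 i)) (q := q)).
  have Sv' : S v' = subst (fun i => y i + cs (lift ord0 i)) f.
    by rewrite /S; congr (subst _ f); apply/funext => i; rewrite /y /v' addrA.
  have D1 : mpow (q + d - 1) (S v' - f).
    by have := subst_diff hX (fun i => hq' (lift ord0 i)) q0 fd; rewrite subst_id.
  have hcs' i := hcs (lift ord0 i).
  have q1 : (0 < q + m)%N by lia.
  have D2 : mpow (q + m + d - 1) (S v' - S v).
    by rewrite Sv'; apply: (subst_diff hy hcs' q1 fd).
  have := subst_taylor hy hcs' q1 fd; rewrite -Sv' -/(S v) => D3.
  have D4 i : mpow (q + d.-1 - 1) (subst y (psderiv i f) - psderiv i f).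
    have := subst_diff hX (fun i => hq (lift ord0 i)) q0 (mpow_deriv i fd).
    by rewrite subst_id.
  (* Once the linear equation solved by [cs] is subtracted, four errors remain: two from the unit
     factor, the Taylor remainder, and the replacement of the derivatives at [y] by those of [f]. *)
  have -> : g - G v' = - (e * (cs ord0 * (S v' - f))) - e * (v ord0 * (S v' - S v))
     - (S v' - S v - \sum_i cs (lift ord0 i) * subst y (psderiv i f))
     - \sum_i cs (lift ord0 i) * (subst y (psderiv i f) - psderiv i f).
    under [X in _ = _ - X]eq_bigr do rewrite mulrBr.
    rewrite sumrB; move: Ecs; rewrite tj_gens_sum /G => Ecs.
    have -> : g = (1 + e * v ord0) * S v + (cs ord0 * (e * f) +
      \sum_i cs (lift ord0 i) * psderiv i f) by rewrite -Ecs; ring.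
    rewrite {1}/v'; ring.
  (* The target order is [k + q + m + 1]. The first two errors would allow [q = k + 2 - d]; the last
     one, and the Taylor remainder at [m = 0], meet the target exactly when [q = k + 3 - d]. *)
  apply: mpowB; first apply: mpowB; first apply: mpowB.
  - by apply/mpowN/mpowMl; apply: mpow_le (mpowM (hcs ord0) D1); lia.
  - by apply: mpowMl; apply: mpow_le (mpowM (hq ord0) D2); lia.
  - by apply: mpow_le D3; lia.
  - by apply: mpow_sum => i _; apply: mpow_le (mpowM (hcs' i) (D4 i)); lia.
have hvq i : mpow q (v i).
  have [v' [[h1 _] h2]] := hv q.
  by rewrite -(subrK (v' i) (v i)); apply: mpowD.
exists (v ord0), (fun i => v (lift ord0 i)); split=> //.
rewrite -/(S v) -/(G v); apply/esym/mpow_eq => m; have [v' [[h1 h2] h3]] := hv m.+1.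
apply: (@mpow_trans _ _ _ _ (G v')); first by apply: mpow_le h2; lia.
have hd i : mpow m.+1 (v' i - v i) by apply: mpow_subC.
have hy : forall i, mpow 1 (psX K i + v (lift ord0 i)).
  by move=> i; apply: (mpow1_add hX (c := fun i => v (lift ord0 i)) (q := q)).
have D : mpow m.+1 (S v' - S v).
  have -> : S v' = subst (fun i => psX K i + v (lift ord0 i) + (v' (lift ord0 i) - v (lift ord0 i))) f.
    by rewrite /S; congr (subst _ f); apply/funext => i; ring.
  by apply: (subst_diff0 hy (fun i => hd (lift ord0 i))).
have -> : G v' - G v = e * ((v' ord0 - v ord0) * S v') + (1 + e * v ord0) * (S v' - S v).
  by rewrite /G; ring.
apply: (mpow_le (leqnSn m)); apply: mpowD; apply: mpowMl => //.
exact: mpowMr.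
Qed.

Lemma in_mpowE k h : in_mpow k h <-> mpow k.+1 h.
Proof. by split=> [hh|[hh] a]; first split=> a; apply: hh. Qed.

Lemma pidealE f h : in_pideal f h <-> exists w, h = w * f.
Proof.
split=> [/in_idealE[cs ->]|[w ->]]; first by exists (cs ord0); rewrite big_ord1.
by apply/in_idealE; exists (fun=> w); rewrite big_ord1.
Qed.

Lemma subst_Kalg_aut y : (forall i, mpow 1 (y i)) -> bijective (subst y) ->
  is_Kalg_aut (subst y).
Proof.
move=> hy bij; split=> //; split; first by move=> f g a; rewrite -[psadd f g]/(f + g) substD.
split; first by move=> f g a; rewrite -[psmul f g in LHS]/(f * g) substM.
split; first by move=> a; rewrite -[@ps1 K s]/(1 : ps K s) -psC1 substC.
by move=> c f a; rewrite !psscaleE substM // substC.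
Qed.

Lemma right_det_newton f k d : (0 < d <= k.+1)%N -> mpow d f ->
  (forall h, mpow k h -> gen_ideal (tj_gens 0 f) h) -> right_det f (2 * k + 2 - d).
Proof.
move=> hd fd Hk g /in_mpowE hg.
have [|a [b [_ hb]]] := @newton 0 f g k d _ hd erefl fd Hk.
  by apply/mpow_subC; move: hg; congr mpow; lia.
rewrite mul0r addr0 mul1r => E.
(* The bound [d <= k.+1] makes [q = k + 3 - d] at least 2. *)
have hb2 i : mpow 2 (b i) by apply: mpow_le (hb i); lia.
exists (subst (fun i => psX K i + b i)); split; last by move=> a'; rewrite E.
apply: subst_Kalg_aut; last exact: subst_tangent_bij.
by move=> i; apply: mpow1_add (@mpow_psX K s) hb2 _ _.
Qed.

Lemma contact_det_newton f k d : (0 < d <= k.+1)%N -> mpow d f ->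
  (forall h, mpow k h -> gen_ideal (tj_gens 1 f) h) -> contact_det f (2 * k + 2 - d).
Proof.
move=> hd fd Hk g /in_mpowE hg.
have [|a [b [ha hb]]] := @newton 1 f g k d _ hd erefl fd Hk.
  by apply/mpow_subC; move: hg; congr mpow; lia.
rewrite mul1r => E.
have hb2 i : mpow 2 (b i) by apply: mpow_le (hb i); lia.
have hy i : mpow 1 (psX K i + b i) by apply: mpow1_add (@mpow_psX K s) hb2 _ _.
have [phiV phiK phiVK] := subst_tangent_bij hb2.
move: E phiK phiVK; set phi := subst _ => E phiK phiVK.
have [w wE] : exists w, w * (1 + a) = 1.
  apply: inverse_exists; have : mpow 1 a by apply: mpow_le ha; lia.
  by rewrite coefD => /mpow1_coef0 ->; rewrite addr0 -psC1 psC_coef0 oner_eq0.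
have E' : phi f = w * g by rewrite -E mulrA wE mul1r.
have refl h : in_pideal g (pssub h h).
  by apply/pidealE; exists 0; rewrite mul0r -[pssub h h]/(h - h) subrr.
exists phi; split; last split; last split; last split; last split; last split.
- move=> u v /pidealE[c e]; apply/pidealE; exists (phi c * w).
  rewrite -mulrA -E' -substM // -e -[pssub u v]/(u - v) substB //.
- by move=> u v; rewrite -[psadd u v]/(u + v) /phi substD //; apply: refl.
- by move=> u v; rewrite -[psmul u v]/(u * v) /phi substM //; apply: refl.
- rewrite -[@ps1 K s]/(1 : ps K s) -{1}psC1 /phi substC // psC1; exact: refl.
- by move=> c u; rewrite !psscaleE /phi substM // substC //; apply: refl.
(* From [g = (1 + a) * phi f], the equation [phi u = c * g] pulls back along [phi] to a multiple of
   [f]. *)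
- move=> u /pidealE[c e]; apply/pidealE; exists (phiV (c * (1 + a))).
  apply: (can_inj phiK); rewrite {2}/phi substM // -/phi phiVK e -E; ring.
- by move=> h; exists (phiV h); rewrite phiVK; apply: refl.
Qed.

Lemma is_ord_mpow f d : is_ord f d -> mpow d f.
Proof. by move=> [_ h]; split. Qed.

(** If [d] exceeded [k.+1], all generators would lie in m^(k+1), while [x_i^k] is in the ideal but
    not in m^(k+1). Thus the subtraction in [2 * k + 2 - d] is never truncated. *)
Lemma ord_le_codim e f k d : in_max f -> is_ord f d ->
  (forall h, mpow k h -> gen_ideal (tj_gens e f) h) -> (0 < d <= k.+1)%N.
Proof.
move=> f0 [[a [ad fa]] fd] Hk.
have d0 : (0 < d)%N.
  rewrite lt0n; apply/eqP => d0; apply: fa; move: ad; rewrite d0 => /eqP.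
  by rewrite mdeg_eq0 => /eqP ->.
rewrite d0 /=; move: d0; rewrite -ad => /= a0.
(* A monomial of positive degree occurs in [f], so there is at least one variable. *)
have [i _] : exists i, (0 < a i)%N.
  apply/existsP; apply: contraLR a0; rewrite negb_exists => /forallP h.
  by rewrite -leqNgt leqn0 /mdeg big1 // => i _; apply/eqP; rewrite -leqn0 leqNgt.
rewrite ad leqNgt; apply/negP => lt.
have [cs E] := Hk _ (mpow_exp k (mpow_psX K i)).
have : mpow k.+1 (psX K i ^+ k).
  have fd' : mpow d f by split.
  rewrite E tj_gens_sum; apply: mpowD.
    by apply/mpowMl/mpowMl; apply: mpow_le fd'; apply: ltnW.
  apply: mpow_sum => j _; apply: mpowMl; apply: mpow_le (mpow_deriv j fd'); lia.
move/mpow_coef/(_ [ffun j => (k * (j == i))%N]).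
rewrite psX_exp /psmono eqxx.
suff hk : (mdeg [ffun j => (k * (j == i))%N] < k.+1)%N by move/(_ hk)/eqP; rewrite oner_eq0.
rewrite ltnS /mdeg (bigD1 i) //= ffunE eqxx muln1 big1 ?addn0 // => j /negPf h.
by rewrite ffunE h muln0.
Qed.
End Determinacy.

(** * High-order perturbations with finite Milnor number *)

Section Perturbation.
Variables (K : fieldType) (s : nat).
Implicit Types (f g h u w : ps K s) (a b c : mono s).

(** The strict degree bound makes the zero polynomial the base case [pdeg 0] of the reduction. *)
Definition pdeg n h : Prop := forall a, (n <= mdeg a)%N -> h a = 0.
Definition trunc n h : ps K s := fun a => if (mdeg a <= n)%N then h a else 0.

Lemma mpow_trunc n h : mpow n.+1 (h - trunc n h).
Proof. by split=> a; rewrite ltnS => la; rewrite coefD coefN /trunc la subrr. Qed.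
Lemma pdeg_trunc n h : pdeg n.+1 (trunc n h).
Proof. by move=> a la; rewrite /trunc leqNgt la. Qed.
Lemma pdeg_deriv n i h : pdeg n.+1 h -> pdeg n (psderiv i h).
Proof. by move=> hn a la; rewrite psderivE hn ?mulr0 // mdegD mdeg_mone addn1. Qed.
Lemma pdeg_psmonoM n c h : pdeg n h -> pdeg (mdeg c + n) (psmono K c * h).
Proof.
move=> hn a la; rewrite psmono_mul; case: ifP => // le; rewrite hn //.
by have := mdegD (msub a c) c; rewrite msubK //; lia.
Qed.

Lemma deriv_psX_exp (i j : 'I_s) n :
  psderiv i (psX K j ^+ n.+1) = (i == j)%:R * n.+1%:R * psX K j ^+ n.
Proof.
elim: n => [|n IH]; first by rewrite expr1 derivX expr0 !mulr1.
by rewrite exprS derivM IH derivX exprS -[n.+2%:R]natr1; ring.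
Qed.

Lemma pdeg_expand n h : pdeg n.+1 h ->
  h = \sum_(a <- boxes s n | (mdeg a <= n)%N) psC (h a) * psmono K a.
Proof.
move=> hn; apply/funext => b; rewrite coef_sum.
transitivity (\sum_(a <- boxes s n | a == b) h a); last first.
  rewrite big_mkcond [RHS]big_mkcond; apply: eq_bigr => a _.
  rewrite psC_mul /psmono; case: (eqVneq a b) => [->|_]; last by rewrite mulr0 if_same.
  by rewrite mulr1; case: ifPn => //; rewrite -ltnNge => /hn.
rewrite sum_box1; case: ifPn => // /notin_boxes hb; exact: hn.
Qed.

(** Two consecutive integers cannot both vanish in [K]. *)
Lemma succ_unit_char k : exists2 D, (k <= D)%N & (D.+1%:R : K) != 0.
Proof.
have [e|h] := eqVneq (k.+1%:R : K) 0; last by exists k.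
by exists k.+1; rewrite // -natr1 e add0r oner_eq0.
Qed.

(* The leading forms of the partial derivatives of [f_{<=k} + sum_i x_i^(D+1)] are
   the [x_i^D], so every polynomial reduces to exponents at most [D]. *)
Lemma milnor_perturbation f k : exists g, mpow k.+1 (f - g) /\
  exists M, forall h, mpow M h -> gen_ideal (milnor_gens g) h.
Proof.
have [D kD Dn] := succ_unit_char k.
pose g : ps K s := trunc k f + \sum_i psX K i ^+ D.+1.
have dg i : psderiv i g = psderiv i (trunc k f) + D.+1%:R * psX K i ^+ D.
  rewrite derivD deriv_sum (bigD1 i) //= deriv_psX_exp eqxx mul1r big1 ?addr0 //.
  by move=> j /negPf h; rewrite deriv_psX_exp eq_sym h !mul0r.
exists g; split.
  rewrite opprD addrA; apply: mpowB; first exact: mpow_trunc.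
  by apply: mpow_sum => i _; apply: mpow_le (mpow_exp D.+1 (mpow_psX K i)).
pose B := boxes s D; exists (size B).
pose v (l : 'I_(size B)) := psmono K (nth (mzero s) B l).
(* The reduction terminates only on polynomials. Since [gen_ideal_chain] asks for a representative
   modulo m^(j+1) only, a truncation suffices. *)
apply: (@gen_ideal_chain _ _ _ _ _ v) => j h _; exists (trunc j h).
pose Sp h := exists c : 'I_(size B) -> K,
  gen_ideal (milnor_gens g) (h - \sum_l psC (c l) * v l).
suff H : forall n u, pdeg n u -> Sp u.
  have [c hc] := H _ _ (@pdeg_trunc j h); exists c; split=> //; exact: mpow_trunc.
have Sp0 : Sp 0.
  exists (fun=> 0); rewrite big1 ?subr0; first exact: gen_ideal0.
  by move=> l _; rewrite psC0 mul0r.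
have SpI u : gen_ideal (milnor_gens g) u -> Sp u.
  by move=> hu; exists (fun=> 0); rewrite big1 ?subr0 // => l _; rewrite psC0 mul0r.
have SpD u w : Sp u -> Sp w -> Sp (u + w).
  move=> [c hc] [d hd]; exists (fun l => c l + d l).
  have := gen_idealD hc hd; congr gen_ideal.
  under [in RHS]eq_bigr do rewrite psCD mulrDl.
  by rewrite big_split /=; ring.
have SpZ k' u : Sp u -> Sp (psC k' * u).
  move=> [c hc]; exists (fun l => k' * c l).
  have := gen_idealM (psC k') hc; congr gen_ideal.
  rewrite mulrBr; congr (_ - _); rewrite big_distrr; apply: eq_bigr => l _ /=.
  by rewrite psCM mulrA.
elim=> {j h} [|n IH] u hu.
  suff -> : u = 0 by [].
  by apply/funext => a; apply: hu.
rewrite (pdeg_expand hu); elim/big_ind: _ => // a an; apply/SpZ.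
case: (boolP (a \in B)) => aB.
  exists (fun l => (nth (mzero s) B l == a)%:R).
  rewrite (_ : psmono K a - _ = 0); first exact: gen_ideal0.
  have hi : (index a B < size B)%N by rewrite index_mem.
  rewrite (bigD1 (Ordinal hi)) //= /v /= nth_index // eqxx mul1r big1 ?addr0 ?subrr //.
  move=> l hl; rewrite (_ : _ == a = false) ?psC0 ?mul0r //.
  apply/negP => /eqP e; case/negP: hl; apply/eqP/val_inj => /=.
  by rewrite -e index_uniq // boxes_uniq.
have [i ai] : exists i, (D < a i)%N.
  move: aB; rewrite mem_boxes negb_forall => /existsP[i hi]; exists i.
  by rewrite ltnNge.
pose b : mono s := [ffun j => (D * (j == i))%N]; pose a' := msub a b.
have ba : mle b a.
  by apply/mleP => j; rewrite ffunE; case: (eqVneq j i) => [->|_] /=; lia.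
have bD : mdeg b = D.
  rewrite /mdeg (bigD1 i) //= ffunE eqxx muln1 big1 ?addn0 // => j /negPf h'.
  by rewrite ffunE h' muln0.
(* A factor [x_i^D] of [x^a] is traded for the derivative of [g]. The rest is a monomial of degree
   [mdeg a - D] times a polynomial of degree below [k <= D], so the degree drops below [mdeg a]. *)
have aE : psmono K a = psC (D.+1%:R^-1) * (psmono K a' * psderiv i g) +
    psC (- D.+1%:R^-1) * (psmono K a' * psderiv i (trunc k f)).
  have e : psC D.+1%:R^-1 * D.+1%:R = 1 :> ps K s.
    by rewrite -psC_nat -psCM mulVf.
  rewrite psCN dg psX_exp -[psmono K a](_ : psmono K a' * psmono K b = _).
    by rewrite -/b -[LHS]mul1r -[X in X * _ = _]e; ring.
  by rewrite psmonoM msubK.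
rewrite aE; apply: SpD; apply/SpZ.
  by apply/SpI/gen_idealM; apply: (gen_ideal_gen (milnor_gens g) i).
apply: IH => x hx; apply: (pdeg_psmonoM (pdeg_deriv i (@pdeg_trunc k f))).
have := mdegD a' b; rewrite msubK // bD; lia.
Qed.
End Perturbation.

(** * Transfer of finite codimension along an equivalence *)

Section Transfer.
Variables (K : fieldType) (s : nat).
Implicit Types (f g h u w : ps K s).

(** Membership in the ideal plus m^r, the form in which approximate information about an equivalence
    can be used. *)
Definition near_ideal n (gs : 'I_n -> ps K s) r h : Prop :=
  exists2 h', gen_ideal gs h' & mpow r (h - h').

Section NearIdeal.
Variables (n : nat) (gs : 'I_n -> ps K s) (r : nat).

Lemma near_idealD f g : near_ideal gs r f -> near_ideal gs r g -> near_ideal gs r (f + g).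
Proof.
move=> [f' hf rf] [g' hg rg]; exists (f' + g'); first exact: gen_idealD.
by rewrite opprD addrACA; apply: mpowD.
Qed.
Lemma near_idealM f g : near_ideal gs r g -> near_ideal gs r (f * g).
Proof.
move=> [g' hg rg]; exists (f * g'); first exact: gen_idealM.
by rewrite -mulrBr; apply: mpowMl.
Qed.
Lemma near_ideal_mpow f : mpow r f -> near_ideal gs r f.
Proof. by move=> hf; exists 0; [apply: gen_ideal0 | rewrite subr0]. Qed.
Lemma near_ideal_gen_ideal f : gen_ideal gs f -> near_ideal gs r f.
Proof. by move=> hf; exists f; rewrite // subrr; apply: mpow0. Qed.
Lemma near_ideal_sum (I : Type) (q : seq I) (P : pred I) (F : I -> ps K s) :
  (forall i, P i -> near_ideal gs r (F i)) -> near_ideal gs r (\sum_(i <- q | P i) F i).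
Proof.
move=> h; elim/big_ind: _ => //; last exact: near_idealD.
by apply: near_ideal_mpow; apply: mpow0.
Qed.
End NearIdeal.

Section LinearPart.
Variables (z : 'I_s -> ps K s) (A : 'M[K]_s).
Hypothesis hz : forall i, mpow 1 (z i).
Hypothesis hA : forall j, mpow 2 (psX K j - \sum_i psC (A j i) * z i).

(** Differentiating [hA] at the origin gives [A *m J = 1]; for square matrices the opposite product
    is then 1 as well, and this is the order needed below. *)
Lemma jacobian_inverse j k :
  mpow 1 (\sum_l psderiv l (z j) * psC (A l k) - (j == k)%:R).
Proof.
pose J := \matrix_(i, l) psderiv l (z i) (mzero s).
have AJ : A *m J = 1%:M.
  apply/matrixP => i l; rewrite !mxE.
  have /mpow1_coef0 := mpow_deriv l (hA i).
  rewrite derivD derivX derivN deriv_sum coefD coefN coef_sum -psC_nat psC_coef0.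
  move/eqP; rewrite subr_eq0 eq_sym => /eqP e.
  rewrite eq_sym -e; apply: eq_bigr => m _.
  by rewrite derivM derivC mul0r add0r psC_mul !mxE.
have /matrixP/(_ j k) := mulmx1C AJ; rewrite !mxE => e.
apply/mpow1_coef0; rewrite coefD coefN -psC_nat psC_coef0 -e coef_sum -sumrB big1 // => l _.
by rewrite mulrC psC_mul !mxE mulrC subrr.
Qed.

(** The Jacobian matrix is inverted only modulo m, by the constant matrix [A]. The leftover has
    coefficients in m, so membership modulo m^r improves to m^(r+1) until [N] is reached. *)
Lemma near_ideal_jacobian n (gs : 'I_n -> ps K s) N (d : 'I_s -> ps K s) :
  (forall j, near_ideal gs N (\sum_i d i * psderiv j (z i))) ->
  forall i, near_ideal gs N (d i).
Proof.
move=> H; suff B r : (r <= N)%N -> forall i, near_ideal gs r (d i) by apply: B.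
elim: r => [|r IH] hr k; first by apply: near_ideal_mpow; apply: mpow_zero.
have -> : d k = \sum_l psC (A l k) * (\sum_i d i * psderiv l (z i)) -
    \sum_i (\sum_l psderiv l (z i) * psC (A l k) - (i == k)%:R) * d i.
  under [X in _ = _ - X]eq_bigr do rewrite mulrBl.
  rewrite sumrB [X in _ = _ - (_ - X)](_ : _ = d k); last first.
    rewrite (bigD1 k) //= eqxx mul1r big1 ?addr0 // => i /negPf ->.
    by rewrite mul0r.
  rewrite [X in _ = X - _](_ : _ = \sum_i (\sum_l psderiv l (z i) * psC (A l k)) * d i).
    by rewrite opprB addrC subrK.
  under eq_bigr do rewrite big_distrr /=.
  rewrite exchange_big; apply: eq_bigr => i _ /=.
  by rewrite big_distrl; apply: eq_bigr => l _ /=; ring.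
apply: near_idealD.
  apply: near_ideal_sum => l _; apply: near_idealM; have [h' h1 h2] := H l.
  by exists h' => //; apply: mpow_le h2.
rewrite -mulN1r; apply: near_idealM; apply: near_ideal_sum => i _.
set mu := (X in X * _); have [h' h1 h2] := IH (ltnW hr) i.
exists (mu * h'); first exact: gen_idealM.
by rewrite -mulrBr -add1n; apply: mpowM h2; apply: jacobian_inverse.
Qed.

(** Replacing each [x_j] by the linear form with coefficients [A j i] inverts the substitution on
    leading forms. One order of precision is all that Nakayama's lemma asks for. *)
Lemma mpow_subst_approx M h : mpow M h ->
  exists h', mpow M h' /\ mpow M.+1 (h - subst z h').
Proof.
elim: M h => [|M IH] h hM.
  exists (psC (h (mzero s))); split; first exact: mpow_zero.
  by rewrite substC; apply: mpow1_subC.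
have /choice [hh hhh] i := IH _ (mpow_pshd i hM).
exists (\sum_j (\sum_i psC (A j i) * psX K i) * hh j); split.
  apply: mpow_sum => j _; rewrite -add1n; apply: mpowM; last by case: (hhh j).
  by apply: mpow_sum => i _; apply/mpowMl/mpow_psX.
rewrite subst_sum // {1}(mpowS_decomp hM) -sumrB; apply: mpow_sum => j _.
have [h1 h2] := hhh j.
have E : subst z (\sum_i psC (A j i) * psX K i) = \sum_i psC (A j i) * z i.
  rewrite subst_sum //; apply: eq_bigr => i _.
  by rewrite substM // substC substX.
rewrite substM // E.
have -> : psX K j * pshd j h - (\sum_i psC (A j i) * z i) * subst z (hh j) =
  psX K j * (pshd j h - subst z (hh j)) +
  (psX K j - \sum_i psC (A j i) * z i) * subst z (hh j) by ring.
apply: mpowD; first by rewrite -add1n; apply: mpowM h2; apply: mpow_psX.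
by rewrite -add2n; apply: mpowM => //; apply: mpow_subst.
Qed.

(** The condition on [v] puts the derivatives of [v * f] in the ideal of [f]. It is vacuous for
    [e = 1]; for [e = 0] it forces the derivatives of [v] to vanish, as they do for [v = 1]. *)
Lemma tj_ideal_transfer (e : K) f g :
  (forall n, exists2 v, mpow n (subst z g - v * f) &
     forall j, exists w, psderiv j v = w * psC e) ->
  forall M, (forall h, mpow M h -> gen_ideal (tj_gens (psC e) g) h) ->
  forall h, mpow M h -> gen_ideal (tj_gens (psC e) f) h.
Proof.
move=> Hg M HM; apply: nakayama_mem => h hM.
suff : near_ideal (tj_gens (psC e) f) M.+1 h by [].
have [h' [h1 h2]] := mpow_subst_approx hM.
have [cs csE] := HM _ h1.
rewrite -(subrK (subst z h') h); apply: near_idealD; first exact: near_ideal_mpow.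
rewrite csE subst_sum //; apply: near_ideal_sum => j _; rewrite substM //.
(* One order beyond [M.+1], because the congruence is differentiated once. *)
apply: near_idealM; have [v hv dv] := Hg M.+2.
have fI : gen_ideal (tj_gens (psC e) f) (psC e * f).
  by have := gen_ideal_gen (tj_gens (psC e) f) ord0; rewrite {2}/tj_gens unlift_none.
have dI i : gen_ideal (tj_gens (psC e) f) (psderiv i f).
  by have := gen_ideal_gen (tj_gens (psC e) f) (lift ord0 i); rewrite {2}/tj_gens liftK.
rewrite /tj_gens; case: unliftP => [i _|_]; last first.
  rewrite substM // substC -(subrK (v * f) (subst z g)) mulrDr; apply: near_idealD.
    by apply/near_idealM/near_ideal_mpow; apply: mpow_le hv.
  by apply: near_ideal_gen_ideal; rewrite mulrCA; apply: gen_idealM.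
move: i; apply: near_ideal_jacobian => j'.
rewrite -chain_rule // -(subrK (v * f) (subst z g)) derivD derivM.
apply: near_idealD; first by apply: near_ideal_mpow; apply: (mpow_deriv j' hv).
apply: near_ideal_gen_ideal; apply: gen_idealD; last exact: gen_idealM.
by have [w ->] := dv j'; rewrite -mulrA; apply: gen_idealM.
Qed.
End LinearPart.

Section Lift.
Variables (f0 g0 : ps K s) (Phi : ps K s -> ps K s).
Hypotheses (hf0 : mpow 2 f0) (hg0 : mpow 1 g0).
Let eqg u v : Prop := exists w, u - v = w * g0.
Hypothesis PhiD : forall u v, eqg (Phi (u + v)) (Phi u + Phi v).
Hypothesis PhiM : forall u v, eqg (Phi (u * v)) (Phi u * Phi v).
Hypothesis PhiC : forall k, eqg (Phi (psC k)) (psC k).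
Hypothesis Phi_inj : forall u, eqg (Phi u) 0 -> exists w, u = w * f0.
Hypothesis Phi_surj : forall h, exists u, eqg (Phi u) h.

Let eqg_refl u : eqg u u. Proof. by exists 0; rewrite subrr mul0r. Qed.
Let eqg_sym u v : eqg u v -> eqg v u.
Proof. by case=> w e; exists (- w); rewrite mulNr -e opprB. Qed.
Let eqg_trans v u w : eqg u v -> eqg v w -> eqg u w.
Proof. by move=> [a ea] [b eb]; exists (a + b); rewrite mulrDl -ea -eb addrA subrK. Qed.
Let eqgD u u' v v' : eqg u u' -> eqg v v' -> eqg (u + v) (u' + v').
Proof. by move=> [a ea] [b eb]; exists (a + b); rewrite mulrDl -ea -eb opprD addrACA. Qed.
Let eqgM u u' v v' : eqg u u' -> eqg v v' -> eqg (u * v) (u' * v').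
Proof.
move=> [a ea] [b eb]; exists (a * v + u' * b).
have -> : u = u' + a * g0 by rewrite -ea addrC subrK.
have -> : v = v' + b * g0 by rewrite -eb addrC subrK.
ring.
Qed.

(** The [z i] are preimages of the variables under [Phi] modulo [g0]. Expanding [h] to order [n] and
    lifting the pieces gives a preimage close to [h(z)]; it may depend on [n], as [Phi] is not
    assumed continuous. With [f0 = g0 = 0] this treats automorphisms. *)
Lemma coordinate_lift : exists z : 'I_s -> ps K s, exists A : 'M[K]_s,
  [/\ forall i, mpow 1 (z i),
      forall j, mpow 2 (psX K j - \sum_i psC (A j i) * z i) &
      forall n h, exists2 h', eqg (Phi h') h & mpow n (h' - subst z h)].
Proof.
have /choice [z Pz] i := Phi_surj (psX K i).
(* If [z i] were a unit, its image [x_i] would be invertible modulo [g0], although both lie in m. *)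
have hz i : mpow 1 (z i).
  apply/mpow1_coef0/eqP/negPn/negP => /inverse_exists[w wz].
  have : eqg 1 (Phi w * psX K i).
    apply: (eqg_trans (v := Phi 1)); first by apply: eqg_sym; apply: (PhiC 1).
    rewrite -wz; apply: (eqg_trans (PhiM _ _)); exact: eqgM.
  case=> v e; have : mpow 1 (psC 1 : ps K s).
    rewrite psC1 -(subrK (Phi w * psX K i) 1) e.
    by apply: mpowD; apply: mpowMl => //; apply: mpow_psX.
  by move/mpow1_psC/eqP; rewrite oner_eq0.
have lift n h : exists2 h', eqg (Phi h') h & mpow n (h' - subst z h).
  elim: n h => [|n IH] h.
    by have [u hu] := Phi_surj h; exists u => //; apply: mpow_zero.
  have B i : exists h', eqg (Phi h') (pshd i h) /\ mpow n (h' - subst z (pshd i h)).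
    by have [h' ? ?] := IH (pshd i h); exists h'.
  have [hh hhh] := choice B.
  exists (psC (h (mzero s)) + \sum_i z i * hh i).
    rewrite [X in eqg _ X]pshd_decomp; apply: (eqg_trans (PhiD _ _)); apply: eqgD => //.
    elim/big_rec2: _ => [|i u v _ IHuv]; first by have := PhiC 0; rewrite psC0.
    apply: (eqg_trans (PhiD _ _)); apply: eqgD => //.
    by apply: (eqg_trans (PhiM _ _)); apply: eqgM => //; case: (hhh i).
  rewrite {2}(pshd_decomp h) substD substC subst_sum // opprD addrACA subrr add0r -sumrB.
  apply: mpow_sum => i _; rewrite substM // substX // -mulrBr -add1n.
  by apply: mpowM => //; case: (hhh i).
(* The lift [h'] of [h = Phi x_j] has the same image as [x_j], so they differ by a multiple of [f0].
   As [f0] lies in m^2, [x_j] agrees with [h(z)] modulo m^2, and the linear part of [h] gives the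
   coefficients. *)
have lin j : exists c : 'I_s -> K, mpow 2 (psX K j - \sum_i psC (c i) * z i).
  have [h' h1 h2] := lift 2%N (Phi (psX K j)); set h := Phi (psX K j) in h1 h2.
  have [w ew] : exists w, h' - psX K j = w * f0.
    apply: Phi_inj.
    have PN u : eqg (Phi (- u)) (- Phi u).
      rewrite -mulN1r -[- Phi u]mulN1r -psC1 -psCN.
      by apply: (eqg_trans (PhiM _ _)); apply: eqgM.
    apply: (eqg_trans (PhiD _ _)); rewrite -(subrr h).
    by apply: eqgD => //; apply: PN.
  have X1 : mpow 2 (psX K j - subst z h).
    have -> : psX K j - subst z h = (h' - subst z h) - w * f0 by rewrite -ew; ring.
    by apply: mpowB => //; apply: mpowMl.
  have S1 : subst z h = psC (h (mzero s)) + \sum_i z i * subst z (pshd i h).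
    rewrite {1}(pshd_decomp h) substD substC subst_sum //; congr (_ + _).
    by apply: eq_bigr => i _; rewrite substM // substX.
  have h0 : h (mzero s) = 0.
    apply: (@mpow1_psC K s).
    have -> : psC (h (mzero s)) = psX K j - \sum_i z i * subst z (pshd i h)
      - (psX K j - subst z h) by rewrite S1; ring.
    apply: mpowB; last exact: mpow_le X1.
    by apply: mpowB (mpow_psX _ _) _; apply: mpow_sum => i _; apply: mpowMr.
  exists (fun i => subst z (pshd i h) (mzero s)).
  have -> : psX K j - \sum_i psC (subst z (pshd i h) (mzero s)) * z i =
    (psX K j - subst z h) + \sum_i z i * (subst z (pshd i h) - psC (subst z (pshd i h) (mzero s))).
    under [X in _ = _ + X]eq_bigr do rewrite mulrBr [_ * psC _]mulrC.
    by rewrite sumrB S1 h0 psC0; ring.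
  apply: mpowD => //; apply: mpow_sum => i _; rewrite -[2%N]/(1 + 1)%N.
  by apply: mpowM => //; apply: mpow1_subC.
have [c hc] := choice lin.
exists z, (\matrix_(j, i) c j i); split=> // j.
by under eq_bigr do rewrite mxE.
Qed.
End Lift.

Lemma contact_equiv_tjurina f g M : mpow 2 f -> mpow 1 g -> contact_equiv f g ->
  (forall h, mpow M h -> gen_ideal (tj_gens 1 g) h) ->
  forall h, mpow M h -> gen_ideal (tj_gens 1 f) h.
Proof.
move=> hf hg [Phi [_ [PD [PM [P1 [PZ [Pinj Psurj]]]]]]] HM.
have E u v : in_pideal g (pssub u v) -> exists w, u - v = w * g by move/pidealE.
have PhiC k : exists w, Phi (psC k) - psC k = w * g.
  have [v ev] := E _ _ (PZ k 1); have [w ew] := E _ _ P1.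
  exists (v + psC k * w); rewrite mulrDl -mulrA -ew -ev !psscaleE mulr1 /=.
  by rewrite -[@ps1 K s]/(1 : ps K s); ring.
have [||||z [A [hz hA hl]]] := @coordinate_lift f g Phi hf hg _ _ PhiC.
- by move=> u v; apply/E/PD.
- by move=> u v; apply/E/PM.
- by move=> u [w]; rewrite subr0 => e; apply/pidealE/Pinj/pidealE; exists w.
- move=> h; have [u /E[w e]] := Psurj h; exists u, (- w).
  by rewrite mulNr -e opprB.
rewrite -psC1; apply: (tj_ideal_transfer hz hA _ HM) => n.
(* The lift [g'] of [g] is sent into the ideal of [g], hence is a multiple [v * f]; it is also close
   to [g(z)]. This [v] is the required cofactor. *)
have [g' [w e] hg'] := hl n g.
have /pidealE [v ev] : in_pideal f g'.
  by apply/Pinj/pidealE; exists (w + 1); rewrite mulrDl mul1r -e subrK.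
exists v; first by rewrite -ev; apply: mpow_subC.
by move=> j; exists (psderiv j v); rewrite psC1 mulr1.
Qed.

Lemma right_equiv_milnor f g M : right_equiv f g ->
  (forall h, mpow M h -> gen_ideal (tj_gens 0 g) h) ->
  forall h, mpow M h -> gen_ideal (tj_gens 0 f) h.
Proof.
move=> [phi [[[psi phiK psiK] [PD [PM [P1 PZ]]]] Pf]] HM.
have PhiC k : phi (psC k) = psC k.
  have -> : psC k = psscale k 1 :> ps K s by rewrite psscaleE mulr1.
  apply/funext => a; rewrite PZ; congr (psscale k _ a).
  by apply/funext => b; rewrite P1.
have pf : phi f = g by apply/funext.
have Z (u v : ps K s) : u = v -> exists w, u - v = w * 0.
  by move=> ->; exists 0; rewrite mul0r subrr.
(* With zero ideals the congruences become equalities, so the lift of [g] is [f] itself and the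
   cofactor is 1. *)
have [|||||z [A [hz hA hl]]] := @coordinate_lift 0 0 phi (@mpow0 K s _) (@mpow0 K s _).
- by move=> u v; apply/Z/funext => a; apply: PD.
- by move=> u v; apply/Z/funext => a; apply: PM.
- by move=> k; apply: Z.
- move=> u [w]; rewrite mulr0 subr0 => e; exists 0; rewrite mul0r.
  by apply: (can_inj phiK); rewrite e -[0 in RHS]psC0 PhiC psC0.
- by move=> h; exists (psi h); apply: Z.
rewrite -(psC0 K s); apply: (tj_ideal_transfer hz hA); last by rewrite psC0; exact: HM.
move=> n; have [g' [w]] := hl n g; rewrite mulr0 => /eqP; rewrite subr_eq0 => /eqP e hg'.
have eg : g' = f by apply: (can_inj phiK); rewrite e pf.
exists 1; first by rewrite mul1r -eg; apply: mpow_subC.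
by move=> j; exists 0; rewrite mul0r -psC1 derivC.
Qed.

(** A nonzero linear term makes one partial derivative a unit. *)
Lemma tjurina_ideal_order1 f : mpow 1 f -> ~ mpow 2 f ->
  forall h, gen_ideal (tj_gens 1 f) h.
Proof.
move=> f1 f2.
have [i fi] : exists i, f (mone i) != 0.
  apply: contrapT => /forallNP nf; apply: f2; rewrite (mpowS_decomp f1).
  apply: mpow_sum => i _; rewrite -[2%N]/(1 + 1)%N; apply: mpowM (mpow_psX _ _) _.
  apply/mpow1_coef0; rewrite /pshd ifT; last by apply/forallP => j; rewrite ffunE implybT.
  by rewrite maddC madd0; apply/eqP/negPn/negP; apply: nf.
have [|w wE] := @inverse_exists K s (psderiv i f).
  by rewrite psderivE ffunE mul1r maddC madd0.
move=> h; rewrite -(mulr1 h) -[X in h * X]wE; apply/gen_idealM/gen_idealM.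
by have := gen_ideal_gen (tj_gens 1 f) (lift ord0 i); rewrite {2}/tj_gens liftK.
Qed.
End Transfer.


Theorem mainTheorem12 (K : fieldType) (s : nat) (f : ps K s) (hf : in_max f) :
  ((exists k, contact_det f k) <-> (exists t, tjurina_eq f t)) /\
  ((exists k, right_det f k) <-> (exists m, milnor_eq f m)) /\
  (forall t d, tjurina_eq f t -> is_ord f d -> contact_det f (2 * t + 2 - d)) /\
  (forall m d, milnor_eq f m -> is_ord f d -> right_det f (2 * m + 2 - d)).
Proof.
have f1 : mpow 1 f by apply/mpow1_coef0.
have T t : tjurina_eq f t -> forall h, mpow t h -> gen_ideal (tj_gens 1 f) h.
  by rewrite /tjurina_eq tjurina_gensE; apply: quot_dim_mpow.
have M t : milnor_eq f t -> forall h, mpow t h -> gen_ideal (tj_gens 0 f) h.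
  by move=> ht h hh; apply/milnor_idealE; apply: quot_dim_mpow ht h hh.
split; [split|split; [split|split]].
- move=> [k det]; rewrite /tjurina_eq tjurina_gensE.
  case: (pselect (mpow 2 f)) => [f2|nf2]; last first.
    by apply: (@mpow_quot_dim _ _ _ _ 0) => h _; apply: tjurina_ideal_order1.
  have [g [fg [N HN]]] := milnor_perturbation f k.+1.
  apply: (@mpow_quot_dim _ _ _ _ N); apply: (@contact_equiv_tjurina _ _ f g) => //.
  + have -> : g = f - (f - g) by rewrite subKr.
    by apply: mpowB => //; apply: mpow_le fg.
  + by apply: det; apply/in_mpowE; apply: mpow_le fg.
  + move=> h /HN; apply: gen_ideal_trans => i.
    by have := gen_ideal_gen (tj_gens 1 g) (lift ord0 i); rewrite {2}/tj_gens liftK.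
(* Taking [d = 1], from [f] in m alone, avoids the order, which does not exist for [f = 0]. *)
- by move=> [t ht]; exists (2 * t + 2 - 1)%N; apply: contact_det_newton f1 (T t ht).
- move=> [k det]; have [g [fg [N HN]]] := milnor_perturbation f k.
  apply: (@mpow_quot_dim _ _ _ _ N) => h hh; apply/milnor_idealE; move: h hh.
  apply: (@right_equiv_milnor _ _ f g); first by apply: det; apply/in_mpowE.
  by move=> h /HN/milnor_idealE.
- by move=> [m hm]; exists (2 * m + 2 - 1)%N; apply: right_det_newton f1 (M m hm).
- move=> t d ht hd; apply: contact_det_newton (is_ord_mpow hd) (T t ht).
  exact: ord_le_codim hf hd (T t ht).
- move=> m d hm hd; apply: right_det_newton (is_ord_mpow hd) (M m hm).
  exact: ord_le_codim hf hd (M m hm).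
Qed.
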